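(* Assume $\mu$ is atomless ($T=T_0$) and that (A$_1$), (A$_2$), (A$_3'$), (A$_4'$) and (A$_5$) hold. Let $f$ be an exactly feasible allocation that is not in the NY-strong fine core. Then for every $\epsilon$ with $0<\epsilon<\mu(T)$ there is a coalition $S$ with $\mu(S)=\epsilon$ that NY-strongly fine blocks $f$.
   Context: Standing setup. $\Omega$ is a finite set of states with a $\sigma$-algebra $\mathcal F$. $(T,\Sigma,\mu)$ is a complete, finite, positive measure space of agents. $Y$ is an ordered Banach space whose positive cone $Y_+$ has nonempty interior; $x\gg0$ means $x\in\operatorname{int}Y_+$, $x>0$ means $x\in Y_+\setminus\{0\}$. Each agent $t$ has a partition $\Pi_t$ of $\Omega$ generating a $\sigma$-algebra $\mathcal F_t$, a utility $U_t:\Omega\times Y_+\to\mathbb R$, an initial endowment $a(t,\cdot):\Omega\to Y_+$ constant on elements of $\Pi_t$, and a prior $q_t$ with $q_t(\omega)>0$. $V_t(x)=\sum_\omega U_t(\omega,x(\omega))q_t(\omega)$. $a(\cdot,\omega)$ is Bochner integrable on $T$. A coalition is $S\in\Sigma$ with $\mu(S)>0$; a sub-coalition of $S$ is a coalition contained in $S$. An $S$-assignment is $f:S\times\Omega\to Y_+$ with $f(\cdot,\omega)$ Bochner integrable on $S$ for each $\omega$; it is $S$-exactly feasible if $\int_S f(\cdot,\omega)d\mu=\int_S a(\cdot,\omega)d\mu$ for all $\omega$ (exactly feasible when $S=T$). An allocation is a $T$-assignment $f$ with $f(t,\cdot)$ $\mathcal F_t$-measurable for a.e. $t$. For a partition $\mathcal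 Q$ of $\Omega$, $T_{\mathcal Q}=\{t:\Pi_t=\mathcal Q\}$; $\mathfrak P_S=\{\mathcal Q:S\cap T_{\mathcal Q}\ne\emptyset\}$; $\bigvee\mathfrak Q$ is the $\sigma$-algebra generated by the coarsest common refinement of all members of a family $\mathfrak Q$ of partitions. An allocation $f$ is NY-strongly fine blocked by a coalition $S$ if there exist a sub-coalition $S_0$ of $S$ and an $S$-exactly feasible $S$-assignment $g$ such that $g(t,\cdot)$ is $\bigvee\mathfrak P_S$-measurable and $V_t(g(t,\cdot))\ge V_t(f(t,\cdot))$ for a.e. $t\in S$, and $V_t(g(t,\cdot))>V_t(f(t,\cdot))$ for a.e. $t\in S_0$. The NY-strong fine core is the set of exactly feasible allocations not NY-strongly fine blocked by any coalition. (A$_1$): $t\mapsto q_t$ is measurable and $T_{\mathcal Q}\in\Sigma$ for all partitions $\mathcal Q$. (A$_2$): for each $\omega$, $t\mapsto U_t(\omega,x)$ is measurable and $U_t(\omega,\cdot)$ is norm-continuous. (A$_3'$): for all $(t,\omega)$ and $x,y\in Y_+$ with $y>0$, $U_t(\omega,x+y)>U_t(\omega,x)$. (A$_4'$): $U_t(\omega,\cdot)$ is concave for all $(t,\omega)$. (A$_5$): $a(t,\omega)\gg0$ for all $(t,\omega)$. *)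

(* Defs.v *)
From HB Require Import structures.
From mathcomp Require Import all_boot all_order all_algebra.
From mathcomp Require Import all_classical all_reals all_analysis.
Set Implicit Arguments. Unset Strict Implicit. Unset Printing Implicit Defensive.
Import Order.TTheory GRing.Theory Num.Theory.
Import numFieldNormedType.Exports.
Local Open Scope classical_set_scope.
Local Open Scope ring_scope.

Definition ordered_banach_cone {R : realType} {Y : completeNormedModType R}
  (Yp : set Y) : Prop :=
  [/\ closed Yp, Yp 0,
      (forall x y, Yp x -> Yp y -> Yp (x + y)),
      (forall (c : R) x, 0 <= c -> Yp x -> Yp (c *: x)) &
      (forall x, Yp x -> Yp (- x) -> x = 0)].

Definition complete_measure {d} {T : measurableType d} {R : realType}
  (mu : {measure set T -> \bar R}) : Prop :=
  forall N, measurable N -> mu N = 0%E -> forall A, A `<=` N -> measurable A.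

Definition atomless {d} {T : measurableType d} {R : realType}
  (mu : {measure set T -> \bar R}) : Prop :=
  forall A, measurable A -> (0 < mu A)%E ->
    exists B, [/\ measurable B, B `<=` A, (0 < mu B)%E & (mu B < mu A)%E].

Section Bochner.
Context {d} {T : measurableType d} {R : realType} {Y : completeNormedModType R}.
Variable mu : {measure set T -> \bar R}.

Definition simple_fun := seq (set T * Y).
Definition simple_ok (s : simple_fun) : Prop :=
  forall p, p \in s -> measurable p.1 /\ (mu p.1 < +oo)%E.
Definition simple_eval (s : simple_fun) (t : T) : Y :=
  \sum_(p <- s) ((\1_(p.1) t : R) *: p.2).
Definition simple_integral (S : set T) (s : simple_fun) : Y :=
  \sum_(p <- s) (fine (mu (p.1 `&` S)) *: p.2).

Definition bochner_integral_is (S : set T) (f : T -> Y) (y : Y) : Prop :=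
  exists s : nat -> simple_fun,
    [/\ forall n, simple_ok (s n),
        ({ae mu, forall t, S t -> (fun n => simple_eval (s n) t) @ \oo --> f t}),
        (fun n => (\int[mu]_(t in S) (`| f t - simple_eval (s n) t |)%:E)%E)
           @ \oo --> 0%E &
        (fun n => simple_integral S (s n)) @ \oo --> y].

Definition bochner_integrable (S : set T) (f : T -> Y) : Prop :=
  exists y, bochner_integral_is S f y.
End Bochner.

Section Economy.
Context {d} {T : measurableType d} {R : realType} {Y : completeNormedModType R}
  {Omega : finType}.
Variable mu : {measure set T -> \bar R}.
Variable Yp : set Y.
Variable Pi : T -> {set {set Omega}}.      (* information partitions *)
Variable U : T -> Omega -> Y -> R.         (* state-dependent utilities *)
Variable q : T -> Omega -> R.              (* priors *)
Variable a : T -> Omega -> Y.              (* initial endowments *)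

(* x : Omega -> Y is measurable w.r.t. the sigma-algebra generated by the
   (finite) partition P: it is constant on each block of P *)
Definition partition_measurable (P : {set {set Omega}}) (x : Omega -> Y) :=
  forall w w', finset.pblock P w = finset.pblock P w' -> x w = x w'.

Definition V (t : T) (x : Omega -> Y) : R :=
  \sum_(w : Omega) U t w (x w) * q t w.

Definition coalition (S : set T) := measurable S /\ (0 < mu S)%E.

Definition assignment (S : set T) (f : T -> Omega -> Y) : Prop :=
  (forall t w, S t -> Yp (f t w)) /\
  (forall w, bochner_integrable mu S (fun t => f t w)).

Definition exactly_feasible_on (S : set T) (f : T -> Omega -> Y) : Prop :=
  forall w, exists y, bochner_integral_is mu S (fun t => f t w) y /\
                      bochner_integral_is mu S (fun t => a t w) y.

Definition allocation (f : T -> Omega -> Y) : Prop :=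
  assignment setT f /\
  {ae mu, forall t, partition_measurable (Pi t) (f t)}.

(* x : Omega -> Y is measurable w.r.t. \/ P_S, where P_S is the set of
   partitions Pi_s for s in S: constant on each cell of the coarsest common
   refinement of these partitions *)
Definition join_measurable (S : set T) (x : Omega -> Y) : Prop :=
  forall w w', (forall s, S s -> finset.pblock (Pi s) w = finset.pblock (Pi s) w') ->
    x w = x w'.

Definition NY_strongly_fine_blocks (S : set T) (f : T -> Omega -> Y) : Prop :=
  coalition S /\
  exists S0 g, [/\ (coalition S0 /\ S0 `<=` S),
    assignment S g, exactly_feasible_on S g,
    ({ae mu, forall t, S t ->
       join_measurable S (g t) /\ V t (f t) <= V t (g t)}) &
    ({ae mu, forall t, S0 t -> V t (f t) < V t (g t)})].

Definition NY_strong_fine_core (f : T -> Omega -> Y) : Prop :=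
  allocation f /\ exactly_feasible_on setT f /\
  forall S, ~ NY_strongly_fine_blocks S f.

Definition standing_setup : Prop :=
  [/\ (ordered_banach_cone Yp /\ (exists x, interior Yp x) /\
       complete_measure mu /\ (mu setT < +oo)%E),
      (forall t, finset.partition (Pi t) [set: Omega]),
      ((forall t w, 0 < q t w) /\ (forall t, \sum_(w : Omega) q t w = 1)),
      ((forall t w, Yp (a t w)) /\
        (forall t, partition_measurable (Pi t) (a t))) &
      (forall w, bochner_integrable mu setT (fun t => a t w))].

Definition A1 : Prop :=
  (forall w, measurable_fun setT (fun t => q t w)) /\
  (forall Q : {set {set Omega}}, measurable [set t | Pi t = Q]).

Definition A2 : Prop :=
  (forall w x, measurable_fun setT (fun t => U t w x)) /\
  (forall t w, {within Yp, continuous (U t w)}).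

Definition A3' : Prop :=
  forall t w x y, Yp x -> Yp y -> y <> 0 -> U t w x < U t w (x + y).

Definition A4' : Prop :=
  forall t w x y (l : R), Yp x -> Yp y -> 0 <= l <= 1 ->
    l * U t w x + (1 - l) * U t w y <= U t w (l *: x + (1 - l) *: y).

Definition A5 : Prop := forall t w, interior Yp (a t w).
End Economy.

(* Main.v *)
Require Import Defs.
From HB Require Import structures.
From mathcomp Require Import all_boot all_order all_algebra.
From mathcomp Require Import all_classical all_reals all_analysis.
From mathcomp Require Import measurable_realfun ring lra.
Set Implicit Arguments. Unset Strict Implicit. Unset Printing Implicit Defensive.
Import Order.TTheory GRing.Theory Num.Theory.
Import numFieldNormedType.Exports.
Local Open Scope classical_set_scope.
Local Open Scope ring_scope.

(** A Vind-type argument.  Let [S] block [f] through [g].  Shrinking [g] on a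
    small set of strictly better-off agents frees goods that make everybody in
    [S] strictly better off; shrinking once more, by continuity of utilities,
    leaves a surplus [z] of [a] over [g] in the interior of the cone.  With
    [gamma = 1 - eps / mu T], give [gamma g + (1 - gamma) f] to a fraction
    [alpha] of [S] and [f] to a fraction [alpha (1 - gamma)] of its complement.
    As [f] is exactly feasible, these agents own about [alpha gamma z] more than
    they consume, and they share the excess equally.  Their total mass is
    [alpha (mu S + (1 - gamma) mu (T \ S))], which is [eps] for some
    [alpha <= 1].  In infinite dimensions Lyapunov's theorem holds only
    approximately; the error is absorbed because [z] is interior. *)

(** * Atomless finite measures *)

(** Two accounts of the new coalition must balance: goods and information. Let [x] be the integral
    of [a - f] over [S], a vector of unknown sign. The mixture leaves [gamma z + (1 - gamma) x] on
    [S], and exact feasibility of [f] leaves [- x] on the complement, so the weights [alpha] and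
    [alpha (1 - gamma)] cancel [x]. With this [gamma], the mass at [alpha = 1] is
    [eps + gamma mu S], at least [eps]. As for information, the new coalition must know what [S]
    knows, so the agents sharing a partition are cut in the same proportion as [S]; outsiders only
    add information and keep [f], which respects their own. The excess integrates jointly measurable
    net trades, hence is jointly measurable. An interior surplus cannot be counted on from [g],
    whose values may lie on the boundary of the cone. It comes from the endowments, and for this
    nearly everybody in [S] must accept a cut, which is why the improvement is first made strict
    almost everywhere: the surplus then dominates a fraction of the total endowment of [S], up to a
    small error. *)

Section FiniteMeasure.
Context {d} {T : measurableType d} {R : realType}.
Variable mu : {measure set T -> \bar R}.
Hypothesis mu_fin : (mu setT < +oo)%E.

Definition mass (A : set T) : R := fine (mu A).

Lemma mass_fin A : measurable A -> mu A \is a fin_num.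
Proof.
move=> mA; rewrite ge0_fin_numE//; apply: le_lt_trans mu_fin.
by apply: le_measure; rewrite ?inE.
Qed.

Lemma massE A : measurable A -> mu A = (mass A)%:E.
Proof. by move=> mA; rewrite fineK// mass_fin. Qed.

Lemma mass_ge0 A : 0 <= mass A.
Proof. exact: fine_ge0. Qed.

Lemma mass0 : mass set0 = 0.
Proof. by rewrite /mass measure0. Qed.

Lemma massU A B : measurable A -> measurable B -> A `&` B = set0 ->
  mass (A `|` B) = mass A + mass B.
Proof.
move=> mA mB AB; rewrite /mass measureU// fineD//; exact: mass_fin.
Qed.

Lemma massID A B : measurable A -> measurable B ->
  mass A = mass (A `&` B) + mass (A `\` B).
Proof.
move=> mA mB; rewrite -massU; first by rewrite setUIDK.
- exact: measurableI.
- exact: measurableD.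
- by rewrite setDE setIACA setICr setI0.
Qed.

Lemma le_mass A B : measurable A -> measurable B -> A `<=` B ->
  mass A <= mass B.
Proof.
move=> mA mB AB; rewrite (massID mB mA) setIC (setIidl AB) lerDl.
exact: mass_ge0.
Qed.

Lemma mass_gt0 A : measurable A -> (0 < mu A)%E = (0 < mass A).
Proof. by move=> mA; rewrite massE// lte_fin. Qed.

Lemma mass_eq0 A : measurable A -> (mu A = 0%E) <-> (mass A = 0).
Proof.
by move=> mA; rewrite massE//; split => [[]//|->].
Qed.

Hypothesis mu_atomless : atomless mu.

(** Of the two pieces into which atomlessness cuts a set, one has at most half of the mass; iterated
    halving gets below any [c]. *)
Lemma small_subset A c : measurable A -> 0 < mass A -> 0 < c ->
  exists B, [/\ measurable B, B `<=` A, 0 < mass B & mass B <= c].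
Proof.
move=> mA A0 c0.
have half X : measurable X -> 0 < mass X ->
    exists B, [/\ measurable B, B `<=` X, 0 < mass B & mass B <= mass X / 2].
  move=> mX X0; have := mu_atomless mX; rewrite mass_gt0// => /(_ X0)[B []].
  move=> mB BX; rewrite mass_gt0// !massE// lte_fin => B0 BltX.
  have XE := massID mX mB; rewrite setIC (setIidl BX) in XE.
  have [le2|gt2] := leP (mass B) (mass X / 2); first by exists B.
  exists (X `\` B); split; [exact: measurableD|exact: subDsetl|lra|lra].
have geo n : exists B, [/\ measurable B, B `<=` A, 0 < mass B &
    mass B * 2 ^+ n <= mass A].
  elim: n => [|n [B [mB BA B0 Bn]]]; first by exists A; split=> //; rewrite expr0 mulr1.
  have [C [mC CB C0 Cn]] := half _ mB B0.
  exists C; split=> //; first exact: subset_trans BA.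
  apply: le_trans Bn; rewrite exprS mulrA ler_wpM2r ?exprn_ge0//; lra.
pose n := Num.bound (mass A / c).
have [B [mB BA B0 Bn]] := geo n.
exists B; split=> //.
have nb : mass A / c < 2 ^+ n.
  apply: lt_trans (_ : n%:R < _).
    by apply: archi_boundP; rewrite divr_ge0 ?mass_ge0// ltW.
  by rewrite -natrX ltr_nat ltn_expl.
have p0 : 0 < 2 ^+ n :> R by rewrite exprn_gt0.
rewrite -(ler_pM2r p0); apply: le_trans Bn _.
by rewrite mulrC -ler_pdivrMr// ltW.
Qed.

(** Sierpinski's theorem by greedy exhaustion. Each stage adds a piece at least half as massive as
    any that still fits under [c]. If the union fell short of [c], a small subset of the remainder
    would fit at every stage, and the stages would gain a fixed amount forever. *)
Lemma subset_of_mass A c : measurable A -> 0 <= c <= mass A ->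
  exists B, [/\ measurable B, B `<=` A & mass B = c].
Proof.
move=> mA /andP[c0 cA].
pose adm X C := [/\ measurable C, C `<=` A `\` X & mass X + mass C <= c].
have greedy X : measurable X /\ mass X <= c ->
    exists C, adm X C /\ forall C', adm X C' -> mass C' <= 2 * mass C.
  move=> [mX Xc].
  pose E := [set mass C | C in adm X].
  have E0 : E 0.
    exists set0; last exact: mass0.
    by split=> //; rewrite mass0 addr0.
  have Eub : has_sup E.
    split; first by exists 0.
    exists c => _ [C [_ _ h] <-]; have := mass_ge0 X; lra.
  have [s0|s0] := leP (sup E) 0.
    exists set0; split; first by split=> //; rewrite mass0 addr0.
    move=> C' hC'; rewrite mass0 mulr0; apply: le_trans s0.
    by apply: sup_upper_bound => //; exists C'.
  have hs : 0 < sup E / 2 by lra.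
  have [_ [C hC <-] sC] := sup_adherent hs Eub.
  exists C; split=> // C' hC'.
  have : mass C' <= sup E by apply: sup_upper_bound => //; exists C'.
  lra.
(* The default [set0] makes the choice total; [BP] shows that the sequence built from it never
   violates the guard. *)
have {}greedy X : exists C, measurable X /\ mass X <= c ->
    adm X C /\ forall C', adm X C' -> mass C' <= 2 * mass C.
  have [/greedy[C ?]|?] := pselect (measurable X /\ mass X <= c).
    by exists C.
  by exists set0.
have [next nextP] := choice greedy.
pose B := fix B n := if n is n'.+1 then B n' `|` next (B n') else set0.
have BP n : [/\ measurable (B n), mass (B n) <= c & B n `<=` A].
  elim: n => [|n [mB Bc BA]] /=.
    by split=> //; rewrite mass0.
  have [[mC CD Cc] _] := nextP _ (conj mB Bc).
  split; [exact: measurableU| |].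
  - rewrite massU//; apply/seteqP; split=> // t [Bt /CD[_]]; exact.
  - by move=> t [/BA//|/CD[]].
have BS n : mass (B n.+1) = mass (B n) + mass (next (B n)).
  have [mB Bc BA] := BP n.
  have [[mC CD Cc] _] := nextP _ (conj mB Bc).
  rewrite /= massU//; apply/seteqP; split=> // t [Bt /CD[_]]; exact.
have mUB : measurable (\bigcup_n B n).
  by apply: bigcup_measurable => n _; have [] := BP n.
have Bnd : nondecreasing_seq B.
  by apply/nondecreasing_seqP => n; rewrite subsetEset => t Bt; left.
have UBc : mass (\bigcup_n B n) <= c.
  have := nondecreasing_cvg_mu (mu := mu) (F := B)
    (fun n => let: And3 h _ _ := BP n in h) mUB Bnd.
  move/cvg_lim => /(_ (@ereal_hausdorff R)) lE.
  rewrite -lee_fin -massE// -lE; apply: lime_le.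
    apply: ereal_nondecreasing_is_cvgn => n p np /=.
    have [mn _ _] := BP n; have [mp _ _] := BP p.
    by apply: le_measure; rewrite ?inE//; have := Bnd _ _ np; rewrite subsetEset.
  by apply: nearW => n /=; have [mB Bc _] := BP n; rewrite massE// lee_fin.
exists (\bigcup_n B n); split=> //.
  by move=> t [n _ Bt]; have [_ _] := BP n; apply.
apply/eqP; rewrite eq_le UBc /= leNgt; apply/negP => ltc.
have UBA : \bigcup_n B n `<=` A by move=> t [n _ Bt]; have [_ _] := BP n; apply.
have := massID mA mUB; rewrite setIC (setIidl UBA) => AE.
have D0 : 0 < mass (A `\` \bigcup_n B n) by lra.
have cD : 0 < c - mass (\bigcup_n B n) by lra.
have [C [mC CD C0 Cc]] := small_subset (measurableD mA mUB) D0 cD.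
have lin n : n%:R * (mass C / 2) <= mass (B n).
  elim: n => [|n IH]; first by rewrite mul0r mass_ge0.
  have [mB Bc BA] := BP n.
  have [_ /(_ C)] := nextP _ (conj mB Bc).
  have : adm (B n) C.
    split=> //.
      by move=> t /CD[At nBt]; split=> // Bt; apply: nBt; exists n.
    have : mass (B n) <= mass (\bigcup_n B n).
      by apply: le_mass => // t Bt; exists n.
    lra.
  move=> aC /(_ aC) Cnext; rewrite BS -natr1 mulrDl mul1r.
  by apply: lerD; rewrite // ler_pdivrMr// mulrC.
have C20 : 0 < mass C / 2 by lra.
have := archi_boundP (divr_ge0 c0 (ltW C20)).
rewrite ltr_pdivrMr// => /lt_le_trans /(_ (lin _)).
have [_ + _] := BP (Num.bound (c / (mass C / 2))); lra.
Qed.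

(** Lyapunov's theorem for the finitely many measures given by traces on [L], without any convexity
    argument: [S] is cut along [X] and the induction, which is over all [S], treats the two pieces
    separately. *)
Lemma proportional_subset (L : seq (set T)) S (alpha : R) :
  measurable S -> (forall X, X \in L -> measurable X) -> 0 <= alpha <= 1 ->
  exists B, [/\ measurable B, B `<=` S, mass B = alpha * mass S &
    forall X, X \in L -> mass (B `&` X) = alpha * mass (S `&` X)].
Proof.
move=> mS mL /andP[a0 a1]; elim: L S mS mL => [|X L IH] S mS mL.
  have [|B [mB BS BE]] := @subset_of_mass S (alpha * mass S) mS.
    by rewrite mulr_ge0 ?mass_ge0//= ler_piMl ?mass_ge0.
  by exists B.
have mX : measurable X by apply: mL; rewrite mem_head.
have {}mL Z : Z \in L -> measurable Z by move=> ZL; apply: mL; rewrite inE ZL orbT.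
have [B1 [mB1 B1S B1E B1L]] := IH _ (measurableI _ _ mS mX) mL.
have [B2 [mB2 B2S B2E B2L]] := IH _ (measurableD mS mX) mL.
have d12 : B1 `&` B2 = set0.
  by apply/seteqP; split=> // t [/B1S[_ Xt] /B2S[_]]; exact.
exists (B1 `|` B2); split.
- exact: measurableU.
- by move=> t [/B1S[]|/B2S[]].
- by rewrite massU// B1E B2E -mulrDr -massID.
move=> Z; rewrite inE => /orP[/eqP->|ZL].
  rewrite -B1E; congr mass; apply/seteqP; split=> t.
    by move=> [[//|/B2S[]//]].
  by move=> B1t; split; [left|have [] := B1S _ B1t].
have mZ := mL _ ZL.
rewrite setIUl massU.
- rewrite B1L// B2L// -mulrDr; congr (_ * _).
  have := massID (measurableI _ _ mS mZ) mX.
  rewrite -setIA (setIC Z) setIA => ->; congr (_ + mass _).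
  by rewrite !setDE setIAC.
- exact: measurableI.
- exact: measurableI.
- by rewrite setIACA d12 set0I.
Qed.

End FiniteMeasure.

(** * Simple functions *)

(** A nearest point of a closed set need not exist in infinite dimensions, but off [C] the distance
    is positive, so some point of [C] is within twice that distance. The estimate replaces
    continuity of [P]: along a sequence tending to a point of [C], the projections tend to it as
    well. *)
Lemma closed_near_projection (R : realType) (Y : normedModType R) (C : set Y)
    (y0 : Y) : closed C -> C y0 ->
  exists P : Y -> Y, forall c, C (P c) /\
    forall y, C y -> `|P c - c| <= 2 * `|c - y|.
Proof.
move=> clC Cy0.
suff /choice[P hP] : forall c, exists p, C p /\
    forall y, C y -> `|p - c| <= 2 * `|c - y| by exists P.
move=> c; have [Cc|nCc] := pselect (C c).
  by exists c; split=> // y _; rewrite subrr normr0 mulr_ge0.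
pose E := [set `|c - y| | y in C].
have Einf : has_inf E.
  by split; [exists `|c - y0|; exists y0|exists 0 => _ [y _ <-]].
have : nbhs c (~` C) by apply: open_nbhs_nbhs; split=> //; exact: closed_openC.
rewrite -nbhs_ballE => -[e /= e0 ballC].
have inf0 : e <= inf E.
  apply: lb_le_inf; first by case: Einf.
  move=> _ [y Cy <-]; rewrite leNgt; apply/negP => ye.
  by apply: (ballC y) => //; rewrite -ball_normE /=.
have [_ [p Cp <-] plt] := inf_adherent (lt_le_trans e0 inf0) Einf.
exists p; split=> // y Cy; rewrite distrC.
have : inf E <= `|c - y| by apply: ge_inf; [case: Einf|exists y].
lra.
Qed.

Section SimpleFunctions.
Context {d} {T : measurableType d} {R : realType} {Y : completeNormedModType R}.
Variable mu : {measure set T -> \bar R}.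
Hypothesis mu_fin : (mu setT < +oo)%E.
Implicit Types (s : @simple_fun d T R Y) (S A : set T).

Definition simple_scale (c : R) s : simple_fun := [seq (p.1, c *: p.2) | p <- s].
Definition simple_restrict A s : simple_fun := [seq (p.1 `&` A, p.2) | p <- s].

Lemma simple_eval_cons A y s t :
  simple_eval ((A, y) :: s) t = (\1_A t : R) *: y + simple_eval s t.
Proof. by rewrite /simple_eval big_cons. Qed.

Lemma simple_eval_cat s s' t :
  simple_eval (s ++ s') t = simple_eval s t + simple_eval s' t.
Proof. by rewrite /simple_eval big_cat. Qed.

Lemma simple_eval_scale c s t :
  simple_eval (simple_scale c s) t = c *: simple_eval s t.
Proof.
rewrite /simple_eval big_map scaler_sumr; apply: eq_bigr => p _ /=.
by rewrite !scalerA mulrC.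
Qed.

Lemma simple_eval_restrict A s t :
  simple_eval (simple_restrict A s) t = (\1_A t : R) *: simple_eval s t.
Proof.
rewrite /simple_eval big_map scaler_sumr; apply: eq_bigr => p _ /=.
by rewrite scalerA indicI mulrC.
Qed.

Lemma simple_eval_cst y t : simple_eval [:: (setT : set T, y : Y)] t = y.
Proof. by rewrite /simple_eval big_seq1 /= indicT scale1r. Qed.

Lemma simple_integral_cat S s s' :
  simple_integral mu S (s ++ s') = simple_integral mu S s + simple_integral mu S s'.
Proof. by rewrite /simple_integral big_cat. Qed.

Lemma simple_integral_scale S c s :
  simple_integral mu S (simple_scale c s) = c *: simple_integral mu S s.
Proof.
rewrite /simple_integral big_map scaler_sumr; apply: eq_bigr => p _ /=.
by rewrite !scalerA mulrC.
Qed.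

Lemma simple_integral_restrict S A s :
  simple_integral mu S (simple_restrict A s) = simple_integral mu (A `&` S) s.
Proof.
by rewrite /simple_integral big_map; apply: eq_bigr => p _ /=; rewrite setIA.
Qed.

Lemma simple_ok_cat s s' : simple_ok mu s -> simple_ok mu s' -> simple_ok mu (s ++ s').
Proof.
by move=> h h' p; rewrite mem_cat => /orP[/h|/h'].
Qed.

Lemma simple_ok_scale c s : simple_ok mu s -> simple_ok mu (simple_scale c s).
Proof. by move=> h p /mapP[p' /h p'h ->]. Qed.

Lemma simple_ok_restrict A s : measurable A ->
  simple_ok mu s -> simple_ok mu (simple_restrict A s).
Proof.
move=> mA h p /mapP[p' /h[mp' _] ->] /=; split; first exact: measurableI.
by rewrite ltey_eq mass_fin//; exact: measurableI.
Qed.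

Lemma simple_ok_cst y : simple_ok mu [:: (setT : set T, y : Y)].
Proof. by move=> p; rewrite inE => /eqP -> /=. Qed.

Lemma simple_ok_cons p s : simple_ok mu (p :: s) -> measurable p.1 /\ simple_ok mu s.
Proof.
move=> h; split; first by have [] := h p (mem_head _ _).
by move=> p' p's; apply: h; rewrite inE p's orbT.
Qed.

Lemma simple_integralID S A s : measurable S -> measurable A -> simple_ok mu s ->
  simple_integral mu S s =
  simple_integral mu (S `&` A) s + simple_integral mu (S `\` A) s.
Proof.
move=> mS mA; elim: s => [|p s IH]; rewrite /simple_integral.
  by rewrite !big_nil addr0.
move=> /simple_ok_cons[mp /IH {}IH]; rewrite !big_cons.
rewrite [X in _ + X]IH addrACA; congr (_ + _).
rewrite -scalerDl; congr (_ *: _).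
rewrite [LHS](massID mu_fin (measurableI _ _ mp mS) mA).
by rewrite setIA setIDA.
Qed.

(** The sets listed in a simple function may overlap, so its values cannot be read off the list.
    Peeling off one pair splits the domain along its set, and the gluing premise reassembles the
    pieces. *)
Lemma simple_ind (Q : set T -> (T -> Y) -> Y -> Prop) :
  (forall S x, measurable S -> Q S (fun=> x) (mass mu S *: x)) ->
  (forall S A u v w, measurable S -> measurable A ->
    Q (S `&` A) u v -> Q (S `\` A) u w -> Q S u (v + w)) ->
  (forall S u u' v, measurable S -> (forall t, S t -> u t = u' t) ->
    Q S u v -> Q S u' v) ->
  forall s S, simple_ok mu s -> measurable S ->
    Q S (simple_eval s) (simple_integral mu S s).
Proof.
move=> Qcst Qglue Qcongr.
(* [x] accumulates the values of the sets already peeled off. *)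
suff main s S x : simple_ok mu s -> measurable S ->
    Q S (fun t => x + simple_eval s t) (mass mu S *: x + simple_integral mu S s).
  move=> s S oks mS; have := main s S 0 oks mS; rewrite scaler0 add0r.
  by apply: Qcongr => // t _; rewrite add0r.
elim: s S x => [|[A y] s IH] S x oks mS.
  rewrite /simple_integral big_nil addr0.
  by apply: (Qcongr _ (fun=> x)) (Qcst _ _ mS) => // t _; rewrite /simple_eval big_nil addr0.
have [/= mA oks'] := simple_ok_cons oks.
have mSA := measurableI _ _ mS mA; have mSD := measurableD mS mA.
have -> : mass mu S *: x + simple_integral mu S ((A, y) :: s) =
    (mass mu (S `&` A) *: (x + y) + simple_integral mu (S `&` A) s) +
    (mass mu (S `\` A) *: x + simple_integral mu (S `\` A) s).
  rewrite {1}/simple_integral big_cons -/(simple_integral mu S s) /=.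
  rewrite (simple_integralID mS mA oks') (massID mu_fin mS mA).
  rewrite scalerDl scalerDr (setIC A) -/(mass mu (S `&` A)).
  rewrite -!addrA; congr (_ + _).
  by rewrite [X in _ = _ + X]addrCA [RHS]addrCA.
apply: (Qglue _ A) => //.
- apply: Qcongr (IH _ (x + y) oks' mSA) => // t [_ At].
  by rewrite simple_eval_cons indicE mem_set// scale1r addrA.
- apply: Qcongr (IH _ x oks' mSD) => // t [_ nAt].
  by rewrite simple_eval_cons indicE memNset// scale0r add0r.
Qed.

(** Measurability in [t] for each fixed vector is enough, because a simple function takes finitely
    many values, each on a measurable piece. *)
Lemma measurable_fun_simple_comp d' (Z : measurableType d') (F : T -> Y -> Z) s :
  (forall x, measurable_fun setT (F ^~ x)) -> simple_ok mu s ->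
  measurable_fun setT (fun t => F t (simple_eval s t)).
Proof.
elim: s F => [|[A y] s IH] F mF oks.
  by apply: eq_measurable_fun (mF 0) => t _; rewrite /simple_eval big_nil.
have [/= mA oks'] := simple_ok_cons oks.
(* The value [y] of the peeled set is absorbed into [F], so the induction runs over all [F]. *)
pose F' t x := if t \in A then F t (y + x) else F t x.
have : measurable_fun setT (fun t => F' t (simple_eval s t)).
  apply: IH => // x; apply: measurable_fun_ifT => //.
  apply: (measurable_fun_bool true); rewrite setTI.
  by rewrite (_ : _ @^-1` _ = A)//; apply/seteqP; split=> t /=; [move/set_mem|move/mem_set].
apply: eq_measurable_fun => t _; rewrite /F' simple_eval_cons indicE.
by case: ifP => _; rewrite ?scale1r// scale0r add0r.
Qed.

Lemma measurable_fun_norm_simple s D : simple_ok mu s ->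
  measurable_fun D (fun t => (`|simple_eval s t|)%:E).
Proof.
move=> oks; apply: measurable_funTS; apply/measurable_EFinP.
by apply: (@measurable_fun_simple_comp _ _ (fun=> @Num.norm _ Y)).
Qed.

Lemma norm_simple_integral_le s S : simple_ok mu s -> measurable S ->
  ((`|simple_integral mu S s|)%:E <= \int[mu]_(t in S) (`|simple_eval s t|)%:E)%E.
Proof.
move=> oks mS.
(* Measurability is a premise inside [Q] because the gluing step adds integrals over two disjoint
   pieces. *)
pose Q (S : set T) (u : T -> Y) (v : Y) := measurable_fun S (fun t => (`|u t|)%:E) ->
  ((`|v|)%:E <= \int[mu]_(t in S) (`|u t|)%:E)%E.
suff H : Q S (simple_eval s) (simple_integral mu S s).
  by apply: H; exact: measurable_fun_norm_simple.
apply: simple_ind (oks) (mS) => {s S oks mS}.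
- move=> S x mS _; rewrite integral_cst// massE// normrZ (ger0_norm (mass_ge0 _ _)).
  by rewrite -EFinM mulrC.
- move=> S A u v w mS mA h1 h2 mu_; rewrite -(setUIDK S A).
  have mSA := measurableI _ _ mS mA; have mSD := measurableD mS mA.
  rewrite ge0_integral_setU//.
  + apply: le_trans (_ : (`|v|%:E + `|w|%:E <= _)%E).
      by rewrite -EFinD lee_fin ler_normD.
    by apply: leeD; [apply: h1|apply: h2]; apply: measurable_funS mu_.
  + by rewrite setUIDK.
  + apply/disj_set2P; apply/seteqP; split=> // t [[_ At] [_ nAt]]; exact: nAt.
- move=> S u u' v mS uu' h mu_.
  have mu'_ : measurable_fun S (fun t => (`|u t|)%:E).
    by apply: eq_measurable_fun mu_ => t; rewrite inE => St; rewrite uu'.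
  apply: le_trans (h mu'_) _; rewrite (eq_integral (fun t => (`|u' t|)%:E))//.
  by move=> t; rewrite inE => St; rewrite uu'.
Qed.

End SimpleFunctions.

(** * The Bochner integral *)

Section BochnerIntegral.
Context {d} {T : measurableType d} {R : realType} {Y : completeNormedModType R}.
Variable mu : {measure set T -> \bar R}.
Hypothesis mu_fin : (mu setT < +oo)%E.
Hypothesis mu_complete : complete_measure mu.
Implicit Types (s : @simple_fun d T R Y) (S A : set T) (f g : T -> Y).

(** Completeness makes every function measurable on the null set where convergence may fail;
    elsewhere the limit is pointwise. *)
Lemma ae_cvg_measurable_fun (D : set T) (u : nat -> T -> R) (v : T -> R) :
  measurable D -> (forall n, measurable_fun D (u n)) ->
  {ae mu, forall t, D t -> (fun n => u n t) @ \oo --> v t} ->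
  measurable_fun D v.
Proof.
move=> mD mu_ [N [mN N0 cvN]].
rewrite -(setUIDK D N); apply/measurable_funU.
- exact: measurableI.
- exact: measurableD.
split.
  move=> _ B mB; apply: (mu_complete mN N0) => t [[]] //.
apply: (@measurable_fun_cvg _ _ _ _ u) => [n|t [Dt nNt]].
  by apply: measurable_funS (mu_ n) => // t [].
by apply: contrapT => nc; apply: nNt; apply: cvN => /= /(_ Dt).
Qed.

(** Strong measurability in the sense of Bochner, without integrability. *)
Definition ae_simple_limit S f := exists s : nat -> simple_fun,
  (forall n, simple_ok mu (s n)) /\
  {ae mu, forall t, S t -> (fun n => simple_eval (s n) t) @ \oo --> f t}.

Lemma bochner_ae_simple_limit S f y : bochner_integral_is mu S f y ->
  ae_simple_limit S f.
Proof. by move=> [s [ok cv _ _]]; exists s. Qed.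

(* The values of [F] outside [C] are irrelevant: approximants are first moved
   into [C], at the cost of a factor in their distance to [f t]. *)
Lemma measurable_fun_caratheodory (C : set Y) (F : T -> Y -> R) S f :
  closed C -> C !=set0 -> measurable S ->
  (forall x, measurable_fun setT (F ^~ x)) ->
  (forall t, {within C, continuous (F t)}) ->
  ae_simple_limit S f -> (forall t, S t -> C (f t)) ->
  measurable_fun S (fun t => F t (f t)).
Proof.
move=> clC [y0 Cy0] mS mF cF [s [ok cv]] fC.
have [P hP] := closed_near_projection clC Cy0.
apply: (@ae_cvg_measurable_fun _ (fun n t => F t (P (simple_eval (s n) t)))) => //.
  move=> n; apply: measurable_funTS.
  by apply: (@measurable_fun_simple_comp _ _ _ _ _ _ _ (fun t x => F t (P x))).
apply: filterS cv => t h St; have {}h := h St.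
have PC : (fun n => P (simple_eval (s n) t)) @ \oo --> f t.
  apply/cvgrPdist_lt => e e0.
  (* The projection moves the approximant by at most twice its distance to [f t]: three such
     distances in all. *)
  have e3 : 0 < e / 3 by lra.
  have /cvgrPdist_lt /(_ _ e3) := h.
  apply: filterS => n hn.
  have [_ /(_ _ (fC _ St)) hp] := hP (simple_eval (s n) t).
  have := ler_distD (simple_eval (s n) t) (f t) (P (simple_eval (s n) t)).
  rewrite (distrC (simple_eval _ _) (P _)) (distrC (f t)).
  rewrite (distrC _ (f t)) in hp; lra.
have /subspace_continuousP /(_ _ (fC _ St)) cFt := cF t.
apply: cvg_trans cFt => /= Q; rewrite /nbhs /= /within /= => hQ.
have := PC _ hQ; rewrite /nbhs /=; apply: filterS => n; apply.
by have [] := hP (simple_eval (s n) t).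
Qed.

Lemma ae_simple_limit_measurable_norm S f s : measurable S ->
  ae_simple_limit S f -> simple_ok mu s ->
  measurable_fun S (fun t => (`|f t - simple_eval s t|)%:E).
Proof.
move=> mS hf ok; apply/measurable_EFinP.
apply: (@measurable_fun_caratheodory setT (fun t x => `|x - simple_eval s t|)) => //.
- by exists 0.
- move=> x.
  apply: (@measurable_fun_simple_comp _ _ _ _ mu _ _ (fun t z => `|x - z|)) => //.
- move=> t; apply: continuous_subspaceT => x.
  by apply: cvg_norm; apply: cvgB; [exact: cvg_id|exact: cvg_cst].
Qed.

Definition simple_dist S f s : \bar R :=
  (\int[mu]_(t in S) (`|f t - simple_eval s t|)%:E)%E.

Lemma simple_dist_ge0 S f s : (0 <= simple_dist S f s)%E.
Proof. by apply: integral_ge0 => t _; rewrite lee_fin. Qed.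

Lemma near_simple_dist_lt S f (s : nat -> simple_fun) (e : R) :
  (fun n => simple_dist S f (s n)) @ \oo --> 0%E -> 0 < e ->
  \forall n \near \oo, (simple_dist S f (s n) < e%:E)%E.
Proof. by move=> cd e0; apply: (cd _ (open_ereal_lt' _)); rewrite lte_fin. Qed.

Lemma dist_simple_integral_le S f s s' : measurable S -> ae_simple_limit S f ->
  simple_ok mu s -> simple_ok mu s' ->
  ((`|simple_integral mu S s - simple_integral mu S s'|)%:E <=
    simple_dist S f s + simple_dist S f s')%E.
Proof.
move=> mS hf ok ok'.
have okc : simple_ok mu (s ++ simple_scale (-1) s').
  exact/simple_ok_cat/simple_ok_scale.
have := norm_simple_integral_le mu_fin okc mS.
rewrite simple_integral_cat simple_integral_scale scaleN1r => /le_trans; apply.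
rewrite /simple_dist -ge0_integralD//.
- apply: ge0_le_integral => //.
  + exact: measurable_fun_norm_simple okc.
  + by apply: emeasurable_funD; apply: ae_simple_limit_measurable_norm.
  + move=> t _; rewrite simple_eval_cat simple_eval_scale scaleN1r -EFinD lee_fin.
    by rewrite (distrC (f t)) ler_distD.
- exact: ae_simple_limit_measurable_norm.
- exact: ae_simple_limit_measurable_norm.
Qed.

Lemma bochner_approx S f y (e : R) : bochner_integral_is mu S f y -> 0 < e ->
  exists s, [/\ simple_ok mu s, (simple_dist S f s < e%:E)%E &
    `|y - simple_integral mu S s| < e].
Proof.
move=> [s [ok cv cd ci]] e0.
have /cvgrPdist_lt /(_ _ e0) ci' := ci.
have cd' := near_simple_dist_lt cd e0.
have [n [h1 h2]] := @filter_ex _ (\oo : set_system nat) _ _ (filterI ci' cd').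
by exists (s n).
Qed.

(** The definition of the integral refers to one approximating sequence. A bound against an
    arbitrary simple function frees it from that choice; uniqueness and absolute continuity follow
    from it. *)
Lemma dist_bochner_integral_le S f y s : measurable S ->
  bochner_integral_is mu S f y -> simple_ok mu s ->
  ((`|y - simple_integral mu S s|)%:E <= simple_dist S f s)%E.
Proof.
move=> mS hf ok; apply/lee_addgt0Pr => e e0.
have e2 : 0 < e / 2 by lra.
have [s' [ok' d' i']] := bochner_approx hf e2.
have := dist_simple_integral_le mS (bochner_ae_simple_limit hf) ok' ok.
move=> h.
apply: le_trans (_ : (_ <= (`|y - simple_integral mu S s'| +
   `|simple_integral mu S s' - simple_integral mu S s|)%:E)%E) _.
  by rewrite lee_fin ler_distD.
rewrite EFinD; apply: le_trans (_ : (_ <= (e/2)%:E + ((e/2)%:E + simple_dist S f s))%E) _.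
  apply: leeD; first by rewrite lee_fin ltW.
  by apply: le_trans h _; apply: leeD => //; exact: ltW.
by rewrite addeA -EFinD -splitr addeC.
Qed.

Lemma bochner_integral_unique S f y y' : measurable S ->
  bochner_integral_is mu S f y -> bochner_integral_is mu S f y' -> y = y'.
Proof.
move=> mS hy hy'; apply/eqP; rewrite -subr_eq0 -normr_eq0 eq_le normr_ge0 andbT.
apply/ler_addgt0Pr => e e0; rewrite add0r.
have e2 : 0 < e / 2 by lra.
have [s [ok ds _]] := bochner_approx hy e2.
have := dist_bochner_integral_le mS hy ok.
have := dist_bochner_integral_le mS hy' ok.
move=> /le_lt_trans /(_ ds); rewrite lte_fin => h1.
move=> /le_lt_trans /(_ ds); rewrite lte_fin => h2.
have := ler_distD (simple_integral mu S s) y y'.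
rewrite (distrC (simple_integral mu S s) y'); lra.
Qed.

(** The integrals of approximants that converge in mean form a Cauchy sequence, and completeness of
    [Y] provides the limit. *)
Lemma bochner_integrable_of_cvg S f (s : nat -> simple_fun) : measurable S ->
  (forall n, simple_ok mu (s n)) ->
  {ae mu, forall t, S t -> (fun n => simple_eval (s n) t) @ \oo --> f t} ->
  (fun n => simple_dist S f (s n)) @ \oo --> 0%E ->
  bochner_integrable mu S f.
Proof.
move=> mS ok cv cd.
suff /cvg_ex[y hy] : cvg ((fun n => simple_integral mu S (s n)) @ \oo).
  by exists y, s.
apply/cauchy_cvgP/cauchy_exP => e e0.
have e2 : 0 < e / 2 by lra.
have cd' := near_simple_dist_lt cd e2.
have [m hm] := @filter_ex _ (\oo : set_system nat) _ _ cd'.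
exists (simple_integral mu S (s m)).
rewrite /nbhs /=; apply: filterS cd' => n hn; rewrite -ball_normE /ball_ /=.
have lim : ae_simple_limit S f by exists s.
have := dist_simple_integral_le mS lim (ok m) (ok n).
move=> /le_lt_trans h; rewrite -lte_fin; apply: h.
by rewrite [e]splitr EFinD lteD.
Qed.

Lemma bochner_integrable_subset A S f : measurable A -> measurable S -> A `<=` S ->
  bochner_integrable mu S f -> bochner_integrable mu A f.
Proof.
move=> mA mS AS [y [s [ok cv cd _]]].
have cvA : {ae mu, forall t, A t -> (fun n => simple_eval (s n) t) @ \oo --> f t}.
  by apply: filterS cv => t h /AS.
apply: (bochner_integrable_of_cvg mA ok cvA).
have lim : ae_simple_limit S f by exists s.
apply: squeeze_cvge (cvg_cst 0%E) cd; apply: nearW => n.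
rewrite simple_dist_ge0 /=; apply: ge0_subset_integral => //.
exact: ae_simple_limit_measurable_norm.
Qed.

Lemma bochner_integral_cst S (x : Y) : measurable S ->
  bochner_integral_is mu S (fun=> x) (mass mu S *: x).
Proof.
move=> mS; exists (fun=> [:: (setT, x)]); split.
- by move=> _; exact: simple_ok_cst.
- by apply: aeW => t _; under eq_fun do rewrite simple_eval_cst; exact: cvg_cst.
- rewrite [X in X @ _ --> _](_ : _ = fun=> 0%E); first exact: cvg_cst.
  apply/funext => n; apply: integral0_eq => t _.
  by rewrite simple_eval_cst subrr normr0.
- rewrite /simple_integral; under eq_fun do rewrite big_seq1 /= setTI.
  exact: cvg_cst.
Qed.

Lemma bochner_integral_lin S f g y z (c : R) : measurable S ->
  bochner_integral_is mu S f y -> bochner_integral_is mu S g z ->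
  bochner_integral_is mu S (fun t => c *: f t + g t) (c *: y + z).
Proof.
move=> mS [s [ok cv cd ci]] [s' [ok' cv' cd' ci']].
have okc n : simple_ok mu (simple_scale c (s n) ++ s' n).
  by apply: simple_ok_cat => //; exact: simple_ok_scale.
have cvc : {ae mu, forall t, S t ->
    (fun n => simple_eval (simple_scale c (s n) ++ s' n) t) @ \oo --> c *: f t + g t}.
  apply: filterS2 cv cv' => t h h' St.
  under eq_fun do rewrite simple_eval_cat simple_eval_scale.
  by apply: cvgD; [apply: cvgZr; exact: h|exact: h'].
exists (fun n => simple_scale c (s n) ++ s' n); split => //; last first.
  under eq_fun do rewrite simple_integral_cat simple_integral_scale.
  by apply: cvgD => //; exact: cvgZr.
have limf : ae_simple_limit S f by exists s.
have limg : ae_simple_limit S g by exists s'.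
have lim : ae_simple_limit S (fun t => c *: f t + g t).
  by exists (fun n => simple_scale c (s n) ++ s' n).
have mf n := ae_simple_limit_measurable_norm mS limf (ok n).
have mg n := ae_simple_limit_measurable_norm mS limg (ok' n).
have : (fun n => (`|c|%:E * simple_dist S f (s n) + simple_dist S g (s' n))%E)
    @ \oo --> 0%E.
  rewrite -[X in _ --> X]adde0 -[X in _ --> (X + _)%E](mule0 `|c|%:E).
  by apply: cvgeD => //; apply: cvgeZl.
apply: squeeze_cvge (cvg_cst 0%E); apply: nearW => n.
rewrite simple_dist_ge0 /= /simple_dist -ge0_integralZl//.
rewrite -ge0_integralD//; last by apply: measurable_funeM.
apply: ge0_le_integral => //.
- exact: ae_simple_limit_measurable_norm.
- by apply: emeasurable_funD => //; apply: measurable_funeM.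
move=> t _; rewrite simple_eval_cat simple_eval_scale -EFinM -EFinD lee_fin.
rewrite opprD addrACA -scalerBr -normrZ; exact: ler_normD.
Qed.

Lemma bochner_integral_ae_eq S f g y : measurable S ->
  {ae mu, forall t, S t -> f t = g t} ->
  bochner_integral_is mu S f y -> bochner_integral_is mu S g y.
Proof.
move=> mS fg [s [ok cv cd ci]].
have cv' : {ae mu, forall t, S t -> (fun n => simple_eval (s n) t) @ \oo --> g t}.
  by apply: filterS2 fg cv => t h h' St; rewrite -h//; exact: h'.
have limf : ae_simple_limit S f by exists s.
have limg : ae_simple_limit S g by exists s.
exists s; split => //.
rewrite [X in X @ _ --> _](_ : _ = fun n => simple_dist S f (s n))//.
apply/funext => n; apply: ge0_ae_eq_integral => //.
- exact: ae_simple_limit_measurable_norm.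
- exact: ae_simple_limit_measurable_norm.
- by apply: filterS fg => t h St; rewrite h.
Qed.

(** Convergence is only required almost everywhere, so on a null set the empty simple function
    approximates any [f]. *)
Lemma bochner_integral_null N f : measurable N -> mass mu N = 0 ->
  bochner_integral_is mu N f 0.
Proof.
move=> mN /(mass_eq0 mu_fin mN) N0.
have lim0 : {ae mu, forall t, N t ->
    (fun n : nat => simple_eval ([::] : @simple_fun d T R Y) t) @ \oo --> f t}.
  by exists N; split=> // t /= h; apply: contrapT => nN; apply: h.
have lim : ae_simple_limit N f by exists (fun=> [::]).
exists (fun=> [::]); split => //.
- rewrite [X in X @ _ --> _](_ : _ = fun=> 0%E); first exact: cvg_cst.
  apply/funext => n; apply: null_set_integral => //.
  exact: ae_simple_limit_measurable_norm.
- by rewrite /simple_integral; under eq_fun do rewrite big_nil; exact: cvg_cst.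
Qed.

Lemma bochner_integral_setU A B f y z : measurable A -> measurable B ->
  A `&` B = set0 -> bochner_integral_is mu A f y -> bochner_integral_is mu B f z ->
  bochner_integral_is mu (A `|` B) f (y + z).
Proof.
move=> mA mB AB [s [ok cv cd ci]] [s' [ok' cv' cd' ci']].
pose u n := simple_restrict A (s n) ++ simple_restrict B (s' n).
have evA n t : A t -> simple_eval (u n) t = simple_eval (s n) t.
  move=> At; rewrite simple_eval_cat !simple_eval_restrict !indicE mem_set//.
  rewrite memNset ?scale1r ?scale0r ?addr0// => Bt.
  by have : (A `&` B) t by []; rewrite AB.
have evB n t : B t -> simple_eval (u n) t = simple_eval (s' n) t.
  move=> Bt; rewrite simple_eval_cat !simple_eval_restrict !indicE memNset.
    by rewrite mem_set// scale1r scale0r add0r.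
  by move=> At; have : (A `&` B) t by []; rewrite AB.
have oku n : simple_ok mu (u n).
  by apply: simple_ok_cat; exact: simple_ok_restrict.
have cvu : {ae mu, forall t, (A `|` B) t -> (fun n => simple_eval (u n) t) @ \oo --> f t}.
  apply: filterS2 cv cv' => t h h' [At|Bt].
    by under eq_fun do rewrite evA//; exact: h.
  by under eq_fun do rewrite evB//; exact: h'.
have mU := measurableU _ _ mA mB.
have lim : ae_simple_limit (A `|` B) f by exists u.
exists u; split=> //.
- rewrite [X in X @ _ --> _](_ : _ = fun n =>
      (simple_dist A f (s n) + simple_dist B f (s' n))%E).
    by rewrite -[X in _ --> X]adde0; exact: cvgeD.
  apply/funext => n; rewrite ge0_integral_setU//.
  + congr (_ + _)%E; apply: eq_integral => t; rewrite inE => h.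
      by rewrite evA.
    by rewrite evB.
  + exact: ae_simple_limit_measurable_norm.
  + exact/disj_set2P.
- under eq_fun do rewrite simple_integral_cat !simple_integral_restrict.
  rewrite (setIidl (@subsetUl _ A B)) (setIidl (@subsetUr _ A B)).
  exact: cvgD.
Qed.

(** Near-projection takes the place of separating functionals: moving the values of a simple
    approximant into [C] costs at most twice its distance to [f] in mean, and the integral of a
    simple function with values in [C] is a nonnegative combination of them. Closedness
    concludes. *)
Lemma bochner_integral_in_cone (C : set Y) S f y :
  closed C -> C 0 -> (forall x z, C x -> C z -> C (x + z)) ->
  (forall (c : R) x, 0 <= c -> C x -> C (c *: x)) ->
  measurable S -> (forall t, S t -> C (f t)) ->
  bochner_integral_is mu S f y -> C y.
Proof.
move=> clC C0 CD CZ mS fC hf.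
have [P hP] := closed_near_projection clC C0.
pose Q (S : set T) (u : T -> Y) (v : Y) := (forall t, S t -> C (f t)) ->
  measurable_fun S (fun t => (`|f t - u t|)%:E) ->
  exists2 y', C y' & ((`|v - y'|)%:E <= 2%:E * \int[mu]_(t in S) (`|f t - u t|)%:E)%E.
have main s : simple_ok mu s -> Q S (simple_eval s) (simple_integral mu S s).
  move=> oks; apply: (simple_ind mu_fin (Q := Q)) (oks) (mS) => {y hf s oks S mS fC}.
  - move=> S x mS fC mfx; exists (mass mu S *: P x).
      by apply: CZ; [exact: mass_ge0|exact: (hP x).1].
    rewrite -scalerBr normrZ (ger0_norm (mass_ge0 _ _)) EFinM -massE// muleC.
    rewrite -(integral_cst mu mS) -ge0_integralZl//.
    have m2 : measurable_fun S (fun t => (2%:E * (`|f t - x|)%:E)%E).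
      exact: measurable_funeM.
    apply: (ge0_le_integral mu mS _ _ m2) => [t _||t /fC Cft].
    + by rewrite lee_fin.
    + exact: measurable_cst.
    rewrite -EFinM lee_fin distrC (distrC (f t)).
    exact: (hP x).2.
  - move=> S A u v w mS mA h1 h2 fC mfu.
    have mSA := measurableI _ _ mS mA; have mSD := measurableD mS mA.
    have [||y1 Cy1 le1] := h1; first by move=> t [/fC].
      by apply: measurable_funS mfu.
    have [||y2 Cy2 le2] := h2; first by move=> t [/fC].
      by apply: measurable_funS mfu.
    exists (y1 + y2); first exact: CD.
    rewrite -(setUIDK S A) ge0_integral_setU//.
    + rewrite ge0_muleDr; [|exact: integral_ge0|exact: integral_ge0].
      apply: le_trans (leeD le1 le2); rewrite -EFinD lee_fin opprD addrACA.
      exact: ler_normD.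
    + by rewrite setUIDK.
    + apply/disj_set2P; apply/seteqP; split=> // t [[_ At] [_ nAt]]; exact: nAt.
  - move=> S u u' v mS uu' h fC mfu'.
    have [||y' Cy' le'] := h => //.
      by apply: eq_measurable_fun mfu' => t; rewrite inE => St; rewrite uu'.
    exists y' => //; apply: le_trans le' _.
    rewrite (eq_integral (fun t => (`|f t - u' t|%:E)))// => t.
    by rewrite inE => St; rewrite uu'.
rewrite -[C y](_ : closure C y = C y); last by rewrite -(closure_id C).1.
move=> B; rewrite -nbhs_ballE => -[e /= e0 eB].
(* One quarter for the approximation of [y] and two for the projection leave the total below [e]. *)
have e4 : 0 < e / 4 by lra.
have [s [ok ds ys]] := bochner_approx hf e4.
have [||y' Cy' le'] := main _ ok => //.
  exact: ae_simple_limit_measurable_norm (bochner_ae_simple_limit hf) _.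
exists y'; split=> //; apply: eB; rewrite -ball_normE /ball_ /=.
have : (`|simple_integral mu S s - y'|%:E <= (2 * (e / 4))%:E)%E.
  apply: le_trans le' _; rewrite EFinM; apply: lee_wpmul2l => //.
  exact: ltW.
rewrite lee_fin => h.
have := ler_distD (simple_integral mu S s) y y'; lra.
Qed.

End BochnerIntegral.

(** * Pieces of positive mass, absolute continuity and approximate convexity of the Bochner
    integral *)

Section BochnerSets.
Context {d} {T : measurableType d} {R : realType} {Y : completeNormedModType R}.
Variable mu : {measure set T -> \bar R}.
Hypothesis mu_fin : (mu setT < +oo)%E.
Hypothesis mu_complete : complete_measure mu.
Implicit Types (s : @simple_fun d T R Y) (S A E : set T) (f : T -> Y).

(** Turns a choice made separately by almost every agent into one choice valid on a set of positive
    mass; countability of [I] keeps a union of null pieces null. *)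
Lemma massive_piece (I : countType) (A : I -> set T) S : measurable S ->
  0 < mass mu S -> (forall i, measurable (A i)) ->
  {ae mu, forall t, S t -> exists i, A i t} ->
  exists i, 0 < mass mu (S `&` A i).
Proof.
move=> mS S0 mA cov; apply: contrapT => no.
have A0 i : mass mu (S `&` A i) = 0.
  apply/eqP; rewrite eq_le mass_ge0 andbT leNgt; apply/negP => ?.
  by apply: no; exists i.
pose F k := if unpickle k is Some i then S `&` A i else set0.
have negF k : mu.-negligible (F k).
  rewrite /F; case: unpickle => [i|]; last exact: negligible_set0.
  exists (S `&` A i); split=> //; first exact: measurableI.
  by apply/(mass_eq0 mu_fin); [exact: measurableI|exact: A0].
have : mu.-negligible S.
  apply: negligibleS (negligibleU (negligible_bigcup negF) cov) => t St.
  have [[i Ait]|nAt] := pselect (exists i, A i t).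
    by left; exists (pickle i) => //; rewrite /F pickleK.
  by right => /= /(_ St).
move=> /negligibleP => /(_ mS) /(mass_eq0 mu_fin mS) SE.
by rewrite SE ltxx in S0.
Qed.

Lemma simple_constant_piece s S : simple_ok mu s -> measurable S ->
  0 < mass mu S -> exists E, [/\ measurable E, E `<=` S, 0 < mass mu E &
    exists x, forall t, E t -> simple_eval s t = x].
Proof.
elim: s S => [|[A y] s IH] S ok mS S0.
  exists S; split=> //; exists 0 => t _; by rewrite /simple_eval big_nil.
have [/= mA ok'] := simple_ok_cons ok.
have mSA := measurableI _ _ mS mA; have mSD := measurableD mS mA.
have [SA0|SA0] := ltP 0 (mass mu (S `&` A)).
  have [E [mE ES E0 [x Ex]]] := IH _ ok' mSA SA0.
  exists E; split=> //; first by move=> t /ES[].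
  exists (y + x) => t Et; rewrite simple_eval_cons Ex// indicE mem_set ?scale1r//.
  by have [] := ES _ Et.
have SD0 : 0 < mass mu (S `\` A) by have := massID mu_fin mS mA; lra.
have [E [mE ES E0 [x Ex]]] := IH _ ok' mSD SD0.
exists E; split=> //; first by move=> t /ES[].
exists x => t Et; rewrite simple_eval_cons Ex// indicE memNset ?scale0r ?add0r//.
by have [] := ES _ Et.
Qed.

(** [O] need not be convex, so the mean over [S] may leave it. On a smaller set [f] stays close to
    one vector that has a ball around it inside [O], and the mean stays close to that vector. *)
Lemma mean_in_open (O : set Y) S f y : open O -> measurable S -> 0 < mass mu S ->
  (forall t, S t -> O (f t)) -> bochner_integral_is mu S f y ->
  exists E, [/\ measurable E, E `<=` S, 0 < mass mu E &
    forall z, bochner_integral_is mu E f z -> O ((mass mu E)^-1 *: z)].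
Proof.
move=> oO mS S0 fO hf; have [s [ok cv]] := bochner_ae_simple_limit hf.
pose r k : R := k.+1%:R^-1.
have r0 k : 0 < r k by rewrite /r invr_gt0.
(* Index [(n, k)]: the [n]-th approximant is within [r k] of [f], and the ball of twice this radius
   around it lies in [O]; the factor leaves room for a mean at distance at most [r k]. *)
pose A (i : nat * nat) := S `&` [set t | `|f t - simple_eval (s i.1) t| < r i.2] `&`
  [set t | ball (simple_eval (s i.1) t) (2 * r i.2) `<=` O].
have mA i : measurable (A i).
  apply: measurableI.
    have /measurable_EFinP mn := ae_simple_limit_measurable_norm mu_complete mS
      (bochner_ae_simple_limit hf) (ok i.1).
    rewrite -[X in _ `&` X](_ : (fun t => `|f t - simple_eval (s i.1) t|) @^-1`
      `]-oo, r i.2[%classic = _); first exact: mn.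
    by apply/seteqP; split=> t /=; rewrite in_itv.
  rewrite [X in measurable X](_ : _ = setT `&`
    (fun t => `[< ball (simple_eval (s i.1) t) (2 * r i.2) `<=` O >]) @^-1` [set true]).
    apply: (@measurable_fun_simple_comp _ _ _ _ mu _ _
      (fun t x => `[< ball x (2 * r i.2) `<=` O >])) => //.
  by rewrite setTI; apply/seteqP; split=> t /= /asboolP.
have cov : {ae mu, forall t, S t -> exists i, A i t}.
  apply: filterS cv => t h St; have {}h := h St.
  have : nbhs (f t) O by apply: open_nbhs_nbhs; split=> //; exact: fO.
  rewrite -nbhs_ballE => -[e /= e0 eO].
  have e3 : 0 < e / 3 by lra.
  have [k kr] : exists k, r k < e / 3.
    have [k _ hk] := near_infty_natSinv_lt (PosNum e3).
    by exists k; exact: (hk k (leqnn k)).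
  have /cvgrPdist_lt /(_ _ (r0 k)) h' := h.
  have [n hn] := @filter_ex _ (\oo : set_system nat) _ _ h'.
  exists (n, k); split; first by split.
  move=> x; rewrite -ball_normE /ball_ /= => hx; apply: eO.
  rewrite -ball_normE /ball_ /=.
  have := ler_distD (simple_eval (s n) t) (f t) x; lra.
have [[n k] /= SA0] := massive_piece mS S0 mA cov.
have [E [mE ES E0 [x Ex]]] := simple_constant_piece (ok n) (measurableI _ _ mS (mA _)) SA0.
exists E; split=> //; first by move=> t /ES[].
have Er t : E t -> `|f t - x| < r k.
  by move=> Et; have [_ [[_ /= +] _]] := ES _ Et; rewrite Ex.
have xO : ball x (2 * r k) `<=` O.
  have : E !=set0.
    apply/set0P/negP => /eqP E00; by rewrite E00 mass0 ltxx in E0.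
  by move=> [t Et]; have [_ [_ /=]] := ES _ Et; rewrite Ex.
move=> z hz; apply: xO; rewrite -ball_normE /ball_ /=.
have := dist_bochner_integral_le mu_fin mu_complete mE hz (@simple_ok_cst _ _ _ _ _ mu_fin x).
have -> : simple_integral mu E [:: (setT, x)] = mass mu E *: x.
  by rewrite /simple_integral big_seq1 /= setTI.
have hle : (simple_dist mu E f [:: (setT, x)] <= (r k)%:E * mu E)%E.
  rewrite -(integral_cst mu mE); apply: ge0_le_integral => //.
  - apply: (ae_simple_limit_measurable_norm mu_complete mE) => //.
      exact: bochner_ae_simple_limit hz.
    exact: simple_ok_cst.
  - move=> t Et; rewrite simple_eval_cst lee_fin; exact/ltW/Er.
move=> /le_trans /(_ hle); rewrite massE// -EFinM lee_fin => hz2.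
have xE : x = (mass mu E)^-1 *: (mass mu E *: x).
  by rewrite scalerA mulVf ?lt0r_neq0// scale1r.
rewrite {1}xE -scalerBr normrZ.
rewrite gtr0_norm ?invr_gt0// distrC mulrC ltr_pdivrMr//.
apply: le_lt_trans hz2 _; rewrite ltr_pM2r//; have := r0 k; lra.
Qed.

Lemma simple_distS A S f s : measurable A -> measurable S -> A `<=` S ->
  ae_simple_limit mu S f -> simple_ok mu s ->
  (simple_dist mu A f s <= simple_dist mu S f s)%E.
Proof.
move=> mA mS AS hf ok; apply: ge0_subset_integral => //.
exact: (ae_simple_limit_measurable_norm mu_complete).
Qed.

(** A simple function close to [f] in mean is bounded, so its integral over a small set is small,
    and the error in mean can only decrease on a subset. *)
Lemma bochner_abs_continuous S f y (e : R) : measurable S ->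
  bochner_integral_is mu S f y -> 0 < e ->
  exists2 del : R, 0 < del & forall A z, measurable A -> A `<=` S ->
    mass mu A < del -> bochner_integral_is mu A f z -> `|z| < e.
Proof.
move=> mS hf e0; have e2 : 0 < e / 2 by lra.
have [s [ok ds _]] := bochner_approx hf e2.
(* The summand [1] keeps [M] positive even when all values of [s] vanish. *)
pose M := 1 + \sum_(p <- s) `|p.2|.
have M0 : 0 < M by apply: ltr_pwDl => //; exact: sumr_ge0.
exists (e / 2 / M); first exact: divr_gt0.
move=> A z mA AS Adel hz.
have := dist_bochner_integral_le mu_fin mu_complete mA hz ok.
have hAS := simple_distS mA mS AS (bochner_ae_simple_limit hf) ok.
move=> /le_trans /(_ hAS) /le_lt_trans /(_ ds); rewrite lte_fin => hz1.
have hs : `|simple_integral mu A s| <= mass mu A * M.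
  rewrite /simple_integral; apply: le_trans (ler_norm_sum _ _ _) _.
  rewrite mulrDr mulr1 mulr_sumr; apply: ler_wpDl; first exact: mass_ge0.
  rewrite !big_seq; apply: ler_sum => p ps; rewrite normrZ.
  rewrite ler_wpM2r// ger0_norm ?fine_ge0//; apply: le_mass => //.
  by apply: measurableI => //; have [] := ok p ps.
have : mass mu A * M < e / 2 by rewrite -ltr_pdivlMr.
have := ler_distD (simple_integral mu A s) z 0.
by rewrite !subr0; lra.
Qed.

(** Each [f i] is replaced by a simple function: a subset proportional on all sets occurring in it
    has an exactly proportional integral. The error in mean over [A] and the scaled error over [S]
    are each below [e / 2]. [L] lists further sets to be cut in the same proportion. *)
Lemma approx_lyapunov (I : finType) (f : I -> T -> Y) (y : I -> Y)
    (L : seq (set T)) S (alpha e : R) :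
  atomless mu -> measurable S -> (forall X, X \in L -> measurable X) ->
  0 <= alpha <= 1 -> 0 < e ->
  (forall i, bochner_integral_is mu S (f i) (y i)) ->
  exists A, [/\ measurable A, A `<=` S, mass mu A = alpha * mass mu S,
    (forall X, X \in L -> mass mu (A `&` X) = alpha * mass mu (S `&` X)) &
    forall i z, bochner_integral_is mu A (f i) z -> `|z - alpha *: y i| < e].
Proof.
move=> atl mS mL al e0 hf; have e2 : 0 < e / 2 by lra.
have [s hs] := choice (fun i => bochner_approx (hf i) e2).
pose L' := L ++ flatten [seq [seq p.1 | p <- s i] | i <- enum I].
have mL' X : X \in L' -> measurable X.
  rewrite mem_cat => /orP[/mL//|/flatten_mapP[i _ /mapP[p ps ->]]].
  by have [ok _ _] := hs i; have [] := ok p ps.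
have [A [mA AS AE AL]] := proportional_subset mu_fin atl mS mL' al.
exists A; split=> //.
  by move=> X XL; apply: AL; rewrite mem_cat XL.
move=> i z hz; have [ok ds ys] := hs i.
have IE : simple_integral mu A (s i) = alpha *: simple_integral mu S (s i).
  rewrite /simple_integral scaler_sumr !big_seq; apply: eq_bigr => p ps.
  rewrite scalerA; congr (_ *: _); rewrite setIC (setIC p.1); apply: AL.
  rewrite mem_cat; apply/orP; right; apply/flatten_mapP; exists i.
    by rewrite mem_enum.
  exact: map_f.
have := dist_bochner_integral_le mu_fin mu_complete mA hz ok.
have hAS := simple_distS mA mS AS (bochner_ae_simple_limit (hf i)) ok.
move=> /le_trans /(_ hAS) /le_lt_trans /(_ ds); rewrite lte_fin IE => hz1.
have : `|alpha *: simple_integral mu S (s i) - alpha *: y i| < e / 2.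
  rewrite -scalerBr normrZ distrC; have /andP[a0 a1] := al.
  by rewrite ger0_norm//; apply: le_lt_trans ys; rewrite ler_piMl.
have := ler_distD (alpha *: simple_integral mu S (s i)) z (alpha *: y i); lra.
Qed.

End BochnerSets.

(** * Finite families, and the interior of a convex cone *)

Lemma finite_positive_lower_bound (R : realType) (I : finType) (e : I -> R) :
  (forall i, 0 < e i) -> exists2 e0 : R, 0 < e0 & forall i, e0 <= e i.
Proof.
move=> e_gt0; exists (\big[Order.min/1]_i e i).
  by apply: lt_bigmin => // i _; exact: e_gt0.
by move=> i; exact: bigmin_le.
Qed.

Lemma cvg_sum_seq (R : realType) (I : Type) (r : seq I) (f : I -> nat -> R)
    (l : I -> R) : (forall i, f i @ \oo --> l i) ->
  (fun n => \sum_(i <- r) f i n) @ \oo --> \sum_(i <- r) l i.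
Proof.
move=> fl; elim: r => [|i r IH].
  by under eq_fun do rewrite big_nil; rewrite big_nil; exact: cvg_cst.
under eq_fun do rewrite big_cons; rewrite big_cons.
by apply: cvgD => //; exact: fl.
Qed.

Section ConeInterior.
Context {R : realType} {Y : completeNormedModType R}.
Variable Yp : set Y.
Hypothesis YpD : forall x y, Yp x -> Yp y -> Yp (x + y).
Hypothesis YpZ : forall (c : R) x, 0 <= c -> Yp x -> Yp (c *: x).

Lemma interior_coneD x y : interior Yp x -> Yp y -> interior Yp (x + y).
Proof.
rewrite /interior /= -!nbhs_ballE => -[e /= e0 eY] Yy; exists e => // z.
rewrite -ball_normE /ball_ /= => hz; rewrite -[z](subrK y); apply: YpD => //.
by apply: eY; rewrite -ball_normE /ball_ /= opprB addrA.
Qed.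

Lemma interior_coneZ (c : R) x : 0 < c -> interior Yp x -> interior Yp (c *: x).
Proof.
move=> c0; rewrite /interior /= -!nbhs_ballE => -[e /= e0 eY].
exists (c * e); first exact: mulr_gt0.
move=> z; rewrite -ball_normE /ball_ /= => hz.
rewrite -[z]scale1r -(divff (lt0r_neq0 c0)) -scalerA; apply: YpZ; first exact: ltW.
apply: eY; rewrite -ball_normE /ball_ /=.
have -> : x - c^-1 *: z = c^-1 *: (c *: x - z).
  by rewrite scalerBr scalerA mulVf ?scale1r// lt0r_neq0.
by rewrite normrZ gtr0_norm ?invr_gt0// mulrC ltr_pdivrMr// mulrC.
Qed.

Lemma interior_cone_ball x : interior Yp x ->
  exists2 e : R, 0 < e & forall y, `|y - x| < e -> interior Yp y.
Proof.
move=> Yx; have : nbhs x (interior Yp).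
  by apply: open_nbhs_nbhs; split=> //; exact: open_interior.
rewrite -nbhs_ballE => -[e /= e0 eY]; exists e => // y xy; apply: eY.
by rewrite -ball_normE /ball_ /= distrC.
Qed.

End ConeInterior.

(** * Splitting the Bochner integral along a subset, linearity, and integrals of interior values *)

Section BochnerSplit.
Context {d} {T : measurableType d} {R : realType} {Y : completeNormedModType R}.
Variable mu : {measure set T -> \bar R}.
Hypothesis mu_fin : (mu setT < +oo)%E.
Hypothesis mu_complete : complete_measure mu.

Lemma bochner_integral_merge (E S : set T) (f : T -> Y) y1 y2 :
  measurable E -> measurable S -> E `<=` S -> bochner_integral_is mu E f y1 ->
  bochner_integral_is mu (S `\` E) f y2 -> bochner_integral_is mu S f (y1 + y2).
Proof.
move=> mE mS ES h1 h2; have mD := measurableD mS mE.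
have := bochner_integral_setU mu_fin mu_complete mE mD (setDIK E S) h1 h2.
by rewrite setDUK.
Qed.

Lemma bochner_integral_split (E S : set T) (f : T -> Y) y :
  measurable E -> measurable S -> E `<=` S -> bochner_integral_is mu S f y ->
  exists y1 y2, [/\ bochner_integral_is mu E f y1,
    bochner_integral_is mu (S `\` E) f y2 & y = y1 + y2].
Proof.
move=> mE mS ES hf; have mD := measurableD mS mE.
have intf : bochner_integrable mu S f by exists y.
have [y1 h1] := bochner_integrable_subset mu_fin mu_complete mE mS ES intf.
have [y2 h2] := bochner_integrable_subset mu_fin mu_complete mD mS (@subDsetl _ S E) intf.
exists y1, y2; split=> //.
apply: (bochner_integral_unique mu_fin mu_complete mS hf).
exact: bochner_integral_merge mE mS ES h1 h2.
Qed.

Lemma bochner_integral_sub (S : set T) (f g : T -> Y) y z : measurable S ->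
  bochner_integral_is mu S f y -> bochner_integral_is mu S g z ->
  bochner_integral_is mu S (fun t => f t - g t) (y - z).
Proof.
move=> mS hf hg.
have := bochner_integral_lin mu_complete (-1) mS hg hf.
rewrite scaleN1r addrC; apply: bochner_integral_ae_eq => //.
by apply: aeW => t _; rewrite scaleN1r addrC.
Qed.

Lemma bochner_integral_eq (S : set T) (f g : T -> Y) y : measurable S ->
  (forall t, S t -> f t = g t) ->
  bochner_integral_is mu S f y -> bochner_integral_is mu S g y.
Proof. by move=> mS fg; apply: bochner_integral_ae_eq => //; exact: aeW. Qed.

Lemma bochner_integral_scale (S : set T) (f : T -> Y) y (c : R) : measurable S ->
  bochner_integral_is mu S f y ->
  bochner_integral_is mu S (fun t => c *: f t) (c *: y).
Proof.
move=> mS hf.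
have := bochner_integral_lin mu_complete c mS hf (bochner_integral_cst mu_fin 0 mS).
rewrite scaler0 addr0; apply: bochner_integral_eq => // t _; exact: addr0.
Qed.

Lemma bochner_integral_add (S : set T) (f g : T -> Y) y z : measurable S ->
  bochner_integral_is mu S f y -> bochner_integral_is mu S g z ->
  bochner_integral_is mu S (fun t => f t + g t) (y + z).
Proof.
move=> mS hf hg; have := bochner_integral_lin mu_complete 1 mS hf hg.
rewrite scale1r; apply: bochner_integral_eq => // t _; by rewrite scale1r.
Qed.

(** [bochner_integral_in_cone] only reaches the closed cone. By [mean_in_open] the integral over
    some [E] is a positive multiple of an interior point, and adding the integral over the rest,
    which is in the cone, stays in the interior. *)
Lemma bochner_integral_interior (Yp : set Y) (S : set T) (f : T -> Y) y :
  closed Yp -> Yp 0 -> (forall x z, Yp x -> Yp z -> Yp (x + z)) ->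
  (forall (c : R) x, 0 <= c -> Yp x -> Yp (c *: x)) ->
  measurable S -> 0 < mass mu S -> (forall t, S t -> interior Yp (f t)) ->
  bochner_integral_is mu S f y -> interior Yp y.
Proof.
move=> clY Y0 YD YZ mS S0 fY hf.
have [E [mE ES E0 hE]] := mean_in_open mu_fin mu_complete (@open_interior _ Yp) mS S0 fY hf.
have [y1 [y2 [h1 h2 ->]]] := bochner_integral_split mE mS ES hf.
apply: interior_coneD => //.
  rewrite -[y1]scale1r -(divff (lt0r_neq0 E0)) -scalerA; apply: interior_coneZ => //.
  exact: hE.
apply: (bochner_integral_in_cone mu_fin mu_complete clY Y0 YD YZ _ _ h2).
  exact: measurableD.
by move=> t [St _]; apply: interior_subset; exact: fY.
Qed.

End BochnerSplit.

(** * Expected utility: measurability, monotonicity, concavity, shrinking of bundles *)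

Section Utility.
Context {d} {T : measurableType d} {R : realType} {Y : completeNormedModType R}
  {Omega : finType}.
Variable mu : {measure set T -> \bar R}.
Hypothesis mu_fin : (mu setT < +oo)%E.
Hypothesis mu_complete : complete_measure mu.
Variables (Yp : set Y) (U : T -> Omega -> Y -> R) (q : T -> Omega -> R).
Hypothesis Yp_closed : closed Yp.
Hypothesis Yp0 : Yp 0.
Hypothesis YpZ : forall (c : R) x, 0 <= c -> Yp x -> Yp (c *: x).
Hypothesis q_gt0 : forall t w, 0 < q t w.
Hypothesis q_meas : forall w, measurable_fun setT (fun t => q t w).
Hypothesis U_reg : A2 Yp U.
Hypothesis U_mono : A3' Yp U.
Hypothesis U_concave : A4' Yp U.

Lemma measurable_expected_utility S (x : T -> Omega -> Y) : measurable S ->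
  assignment mu Yp S x -> measurable_fun S (fun t => V U q t (x t)).
Proof.
move=> mS [xY xI]; apply: measurable_sum => w; apply: measurable_funM.
  apply: (@measurable_fun_caratheodory _ _ _ _ _ mu_complete Yp (fun t => U t w)) => //.
  - by exists 0.
  - by have [+ _] := U_reg; exact.
  - by move=> t; have [_] := U_reg; exact.
  - by have [y hy] := xI w; exact: bochner_ae_simple_limit hy.
  - by move=> t St; exact: xY.
exact: measurable_funTS.
Qed.

Lemma measurable_improvement S (x z : T -> Omega -> Y) : measurable S ->
  assignment mu Yp S x -> assignment mu Yp S z ->
  measurable (S `&` [set t | V U q t (x t) < V U q t (z t)]).
Proof.
move=> mS xS zS.
have h := measurable_fun_ltr (measurable_expected_utility mS xS)
  (measurable_expected_utility mS zS).
by apply: (h mS [set true]).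
Qed.

Lemma utility_le t (x y : Omega -> Y) : (forall w, Yp (x w)) -> (forall w, Yp (y w)) ->
  V U q t x <= V U q t (fun w => x w + y w).
Proof.
move=> xY yY; apply: ler_sum => w _; rewrite ler_wpM2r//; first exact: ltW.
have [->|/eqP y0] := eqVneq (y w) 0; first by rewrite addr0.
by apply/ltW/U_mono.
Qed.

Lemma utility_lt t (x y : Omega -> Y) w0 : (forall w, Yp (x w)) ->
  (forall w, Yp (y w)) -> y w0 <> 0 -> V U q t x < V U q t (fun w => x w + y w).
Proof.
move=> xY yY y0; rewrite /V (bigD1 w0)//= [ltRHS](bigD1 w0)//=.
apply: ltr_leD; first by rewrite ltr_pM2r//; exact: U_mono.
apply: ler_sum => w _; rewrite ler_wpM2r//; first exact: ltW.
have [->|/eqP yw0] := eqVneq (y w) 0; first by rewrite addr0.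
by apply/ltW/U_mono.
Qed.

Lemma utility_concave t (x y : Omega -> Y) (l : R) : (forall w, Yp (x w)) ->
  (forall w, Yp (y w)) -> 0 <= l <= 1 ->
  l * V U q t x + (1 - l) * V U q t y <=
  V U q t (fun w => l *: x w + (1 - l) *: y w).
Proof.
move=> xY yY l01; rewrite /V !mulr_sumr -big_split; apply: ler_sum => w _ /=.
rewrite !mulrA -mulrDl ler_wpM2r//; first exact: ltW.
exact: U_concave.
Qed.

Lemma utility_shrink_le t (x : Omega -> Y) (k l : R) : (forall w, Yp (x w)) ->
  0 <= k <= l -> V U q t (fun w => k *: x w) <= V U q t (fun w => l *: x w).
Proof.
move=> xY /andP[k0 kl].
have -> : (fun w => l *: x w) = (fun w => k *: x w + (l - k) *: x w).
  by apply/funext => w; rewrite -scalerDl addrC subrK.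
by apply: utility_le => w; apply: YpZ => //; rewrite subr_ge0.
Qed.

(** Continuity within the cone along multiples of [x]. An integer slack sorts the agents into
    countably many classes, as [massive_piece] and the continuity of [mu] require. *)
Lemma utility_shrink_gt t (x : Omega -> Y) (v : R) : (forall w, Yp (x w)) ->
  v < V U q t x -> exists n, v < V U q t (fun w => (1 - n.+1%:R^-1) *: x w).
Proof.
move=> xY vx.
have xn w : (fun n => (1 - n.+1%:R^-1 : R) *: x w) @ \oo --> x w.
  rewrite -[X in _ --> X]scale1r; apply: cvgZl.
  rewrite -[X in _ --> X]subr0; apply: cvgB; first exact: cvg_cst.
  exact: cvg_harmonic.
have Vn : (fun n => V U q t (fun w => (1 - n.+1%:R^-1) *: x w)) @ \oo --> V U q t x.
  apply: cvg_sum_seq => w; apply: cvgMl.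
  have [_ /(_ t w) /subspace_continuousP /(_ _ (xY w)) cU] := U_reg.
  apply: cvg_trans cU => /= Q; rewrite /nbhs /= /within /= => hQ.
  have := xn w _ hQ; rewrite /nbhs /=; apply: filterS => n; apply.
  by apply: YpZ => //; rewrite subr_ge0 invf_le1// ler1n.
have h : \forall n \near \oo, v < V U q t (fun w => (1 - n.+1%:R^-1) *: x w).
  exact: cvgr_gt Vn _ vx.
by have [n hn] := @filter_ex _ (\oo : set_system nat) _ _ h; exists n.
Qed.

End Utility.

(** * Blocking coalitions *)

Section Blocking.
Context {d} {T : measurableType d} {R : realType} {Y : completeNormedModType R}
  {Omega : finType}.
Variable mu : {measure set T -> \bar R}.
Hypothesis mu_fin : (mu setT < +oo)%E.
Hypothesis mu_complete : complete_measure mu.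
Variables (Yp : set Y) (Pi : T -> {set {set Omega}}).
Variables (U : T -> Omega -> Y -> R) (q : T -> Omega -> R) (a : T -> Omega -> Y).
Hypothesis Yp_closed : closed Yp.
Hypothesis Yp0 : Yp 0.
Hypothesis YpD : forall x y, Yp x -> Yp y -> Yp (x + y).
Hypothesis YpZ : forall (c : R) x, 0 <= c -> Yp x -> Yp (c *: x).
Hypothesis q_gt0 : forall t w, 0 < q t w.
Hypothesis q_meas : forall w, measurable_fun setT (fun t => q t w).
Hypothesis U_reg : A2 Yp U.
Hypothesis U_mono : A3' Yp U.
Hypothesis U_concave : A4' Yp U.
Hypothesis a_interior : forall t w, interior Yp (a t w).
Hypothesis a_meas : forall t, partition_measurable (Pi t) (a t).

Local Notation VV := (V U q).

Lemma assignment_subset A S (f : T -> Omega -> Y) : measurable A -> measurable S ->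
  A `<=` S -> assignment mu Yp S f -> assignment mu Yp A f.
Proof.
move=> mA mS AS [fY fI]; split=> [t w /AS|w]; first exact: fY.
exact: (bochner_integrable_subset mu_fin mu_complete mA mS AS (fI w)).
Qed.

Lemma assignment_scale S (f : T -> Omega -> Y) (c : R) : measurable S -> 0 <= c ->
  assignment mu Yp S f -> assignment mu Yp S (fun t w => c *: f t w).
Proof.
move=> mS c0 [fY fI]; split=> [t w St|w]; first by apply: YpZ => //; exact: fY.
by have [y hy] := fI w; exists (c *: y); exact: bochner_integral_scale.
Qed.

(** In states that [S] cannot tell apart the integrands agree almost everywhere. Goods pooled over a
    part of [S] can therefore be handed out again within the information of [S]. *)
Lemma join_measurable_integral (S E : set T) (g : T -> Omega -> Y) w w' z z' :
  measurable E -> E `<=` S ->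
  {ae mu, forall t, S t -> join_measurable Pi S (g t)} ->
  (forall s, S s -> finset.pblock (Pi s) w = finset.pblock (Pi s) w') ->
  bochner_integral_is mu E (fun t => g t w) z ->
  bochner_integral_is mu E (fun t => g t w') z' -> z = z'.
Proof.
move=> mE ES gJ ww' hz hz'.
apply: (bochner_integral_unique mu_fin mu_complete mE _ hz').
apply: (bochner_integral_ae_eq mu_complete mE _ hz).
by apply: filterS gJ => t h /ES St; exact: (h St).
Qed.

(* On part [E] of [S0], [g] is cut to [(1 - del) g] while [f] stays worse; the
   nonzero amount saved, [del] times the integral of [g] over [E], is spread over
   the rest of [S]. *)
Lemma block_strictly_everywhere S S0 (f g : T -> Omega -> Y) :
  coalition mu S -> coalition mu S0 -> S0 `<=` S ->
  assignment mu Yp S f -> assignment mu Yp S g -> exactly_feasible_on mu a S g ->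
  {ae mu, forall t, S t -> join_measurable Pi S (g t) /\ VV t (f t) <= VV t (g t)} ->
  {ae mu, forall t, S0 t -> VV t (f t) < VV t (g t)} ->
  exists h, [/\ assignment mu Yp S h,
    {ae mu, forall t, S t -> join_measurable Pi S (h t) /\ VV t (f t) < VV t (h t)} &
    forall w, exists y z, [/\ bochner_integral_is mu S (fun t => h t w) y,
      bochner_integral_is mu S (fun t => a t w) z & Yp (z - y)]].
Proof.
move=> [mS Spos] [mS0 S0pos] S0S fS gS feas ae1 ae2.
have [gY gI] := gS.
rewrite mass_gt0// in S0pos.
pose I : countType := (nat * Omega)%type.
(* Index [(n, w)]: an agent of [S0] who still gains when [g] is cut by the factor [1 - 1 / (n + 1)]
   and whose bundle in state [w] is nonzero. *)
pose A (i : I) := (S0 `&` [set t | VV t (f t) < VV t (fun w => (1 - i.1.+1%:R^-1) *: g t w)])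
  `&` (S0 `&` [set t | 0 < `|g t i.2|]).
have gS0 : assignment mu Yp S0 g by exact: assignment_subset gS.
have fS0 : assignment mu Yp S0 f by exact: assignment_subset fS.
have inv01 n : 0 <= 1 - n.+1%:R^-1 :> R by rewrite subr_ge0 invf_le1// ler1n.
have mA i : measurable (A i).
  apply: measurableI.
    have sc := assignment_scale mS0 (inv01 i.1) gS0.
    exact: (measurable_improvement mu_complete Yp_closed Yp0 q_meas U_reg mS0 fS0 sc).
  have [y hy] := (gS0.2 i.2).
  have /measurable_EFinP mn := ae_simple_limit_measurable_norm mu_complete mS0
      (bochner_ae_simple_limit hy) (@simple_ok_cst _ _ _ _ _ mu_fin 0).
  have := measurable_fun_ltr (@measurable_cst _ _ _ _ S0 (0 : R)) mn => hm.
  rewrite (_ : _ `&` _ = S0 `&` (fun t => 0 < `|g t i.2 - simple_eval [:: (setT, 0)] t|)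
    @^-1` [set true]); first exact: hm.
  by apply/seteqP; split=> t /=; rewrite simple_eval_cst subr0.
have cov : {ae mu, forall t, S0 t -> exists i, A i t}.
  apply: filterS ae2 => t h S0t; have {}h := h S0t.
  have gYt w : Yp (g t w) by apply: gY; exact: S0S.
  have fYt w : Yp (f t w) by apply: fS.1; exact: S0S.
  have [n hn] := utility_shrink_gt YpZ U_reg gYt h.
  (* If [g t] were zero, monotonicity would make [f t] at least as good. *)
  have [w gw] : exists w, g t w <> 0.
    apply: contrapT => no.
    have g0 : g t = fun=> 0.
      by apply/funext => w; apply: contrapT => gw; apply: no; exists w.
    have := utility_le q_gt0 U_mono t (x := fun=> 0) (y := f t) (fun=> Yp0) fYt.
    rewrite (_ : (fun w => 0 + f t w) = f t); last by apply/funext => w; rewrite add0r.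
    by move: h; rewrite g0 /VV => /lt_le_trans h /h; rewrite ltxx.
  by exists (n, w); split; split=> //=; rewrite normr_gt0; exact/eqP.
have [[n w0] Apos] := massive_piece mu_fin mS0 S0pos mA cov.
have mS1 := measurableI _ _ mS0 (mA (n, w0)).
have S1S : S0 `&` A (n, w0) `<=` S by move=> t [/S0S].
have gS1 := assignment_subset mS1 mS S1S gS.
(* Applied to the nonzero vectors, [mean_in_open] yields an [E] over which the integral of [g] in
   state [w0] does not vanish. *)
have open_nz : open [set x : Y | x <> 0].
  rewrite openE => x /= x0; rewrite /interior /= -nbhs_ballE.
  exists `|x| => /=; first by rewrite normr_gt0; exact/eqP.
  by move=> z; rewrite -ball_normE /ball_ /= => + z0; rewrite z0 subr0 ltxx.
have [y1 hy1] := gS1.2 w0.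
have [|E [mE ES1 Epos hE]] := mean_in_open mu_fin mu_complete open_nz mS1 Apos _ hy1.
  move=> t [_ [_ [_ /= g0]]] gt0; by rewrite gt0 normr0 ltxx in g0.
have ES := subset_trans ES1 S1S.
have mD := measurableD mS mE.
have mTpos : 0 < mass mu setT.
  by apply: lt_le_trans Epos _; apply: le_mass.
have /choice[zE hzE] := fun w => bochner_integrable_subset mu_fin mu_complete mE mS ES (gI w).
have zEY w : Yp (zE w).
  apply: (bochner_integral_in_cone mu_fin mu_complete Yp_closed Yp0 YpD YpZ mE _ (hzE w)).
  by move=> t Et; apply: gY; exact: ES.
pose del : R := n.+1%:R^-1.
have del0 : 0 < del by rewrite invr_gt0.
(* Dividing by the mass of [T], since that of [S \ E] may vanish, hands out at most what is saved;
   the remainder is why the conclusion claims a surplus in the cone and not equality. *)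
pose r w := (del / mass mu setT) *: zE w.
have rY w : Yp (r w) by apply: YpZ => //; rewrite divr_ge0 ?mass_ge0// ltW.
have r0 : r w0 <> 0.
  apply/eqP; rewrite scaler_eq0 mulf_eq0 invr_eq0 !gt_eqF ?invr_gt0//=.
  have := hE _ (hzE w0) => /eqP; rewrite scaler_eq0 negb_or => /andP[_].
  by move/negbTE->.
pose h t w := if t \in E then (1 - del) *: g t w else g t w + r w.
have hEE t w : E t -> h t w = (1 - del) *: g t w by move=> Et; rewrite /h mem_set.
have hDE t w : (S `\` E) t -> h t w = g t w + r w.
  by move=> [_ nEt]; rewrite /h memNset.
have hint w : exists y z, [/\ bochner_integral_is mu S (fun t => h t w) y,
      bochner_integral_is mu S (fun t => a t w) z & Yp (z - y)].
  have [y [hgy hay]] := feas w.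
  have [yE [yD [hyE hyD yE_]]] := bochner_integral_split mu_fin mu_complete mE mS ES hgy.
  have zyE := bochner_integral_unique mu_fin mu_complete mE hyE (hzE w).
  exists ((1 - del) *: zE w + (yD + mass mu (S `\` E) *: r w)), y; split=> //.
    apply: (bochner_integral_merge mu_fin mu_complete mE mS ES).
      apply: (bochner_integral_eq mu_complete mE _
        (bochner_integral_scale mu_fin mu_complete _ mE (hzE w))).
      by move=> t Et; rewrite hEE.
    apply: (bochner_integral_eq mu_complete mD _
      (bochner_integral_add mu_complete mD hyD (bochner_integral_cst mu_fin (r w) mD))).
    by move=> t Dt; rewrite hDE.
  have -> : y - ((1 - del) *: zE w + (yD + mass mu (S `\` E) *: r w)) =
      (del * (1 - mass mu (S `\` E) / mass mu setT)) *: zE w.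
    rewrite yE_ zyE [X in _ - X]addrCA opprD addrA addrK opprD addrA.
    rewrite scalerBl scale1r opprB addrCA subrr addr0 scalerA -scalerBl.
    by congr (_ *: _); ring.
  apply: YpZ => //; apply: mulr_ge0; first exact: ltW.
  rewrite subr_ge0 ler_pdivrMr// mul1r.
  by apply: le_mass.
exists h; split=> //.
- split=> [t w St|w]; last by have [y [_ [hy _ _]]] := hint w; exists y.
  have [Et|nEt] := pselect (E t); first by rewrite hEE//; by apply: YpZ; [exact: inv01|exact: gY].
  by rewrite hDE//; apply: YpD => //; exact: gY.
have gJ : {ae mu, forall t, S t -> join_measurable Pi S (g t)}.
  by apply: filterS ae1 => t h1 /h1[].
apply: filterS ae1 => t h1 St; have [Jt Vt] := h1 St.
have gYt w : Yp (g t w) by exact: gY.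
split.
  move=> w w' ww'; have gg := Jt w w' ww'.
  have rr : r w = r w'.
    by rewrite /r (join_measurable_integral mE ES gJ ww' (hzE w) (hzE w')).
  by rewrite /h gg rr.
have [Et|nEt] := pselect (E t).
  rewrite (_ : h t = fun w => (1 - del) *: g t w); last by apply/funext => w; rewrite hEE.
  by have [_ [[_ ?] _]] := ES1 _ Et.
rewrite (_ : h t = fun w => g t w + r w); last by apply/funext => w; rewrite hDE.
exact: le_lt_trans Vt (utility_lt q_gt0 U_mono _ gYt rY r0).
Qed.

(** Outside [D n] everybody still gains after a cut by the factor [1 - 1 / (n + 1)]. The sets [D n]
    shrink to a null set, so eventually the integral of [h] over [D n] is too small to push the
    total endowment of [S] out of the interior of the cone. *)
Lemma block_with_interior_surplus S (f h : T -> Omega -> Y) : coalition mu S ->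
  assignment mu Yp S f -> assignment mu Yp S h ->
  {ae mu, forall t, S t -> join_measurable Pi S (h t) /\ VV t (f t) < VV t (h t)} ->
  (forall w, exists y z, [/\ bochner_integral_is mu S (fun t => h t w) y,
      bochner_integral_is mu S (fun t => a t w) z & Yp (z - y)]) ->
  exists g, [/\ assignment mu Yp S g,
    {ae mu, forall t, S t -> join_measurable Pi S (g t) /\ VV t (f t) < VV t (g t)} &
    forall w, exists y z, [/\ bochner_integral_is mu S (fun t => g t w) y,
      bochner_integral_is mu S (fun t => a t w) z & interior Yp (z - y)]].
Proof.
move=> [mS Spos] fS hS ae1 hint; rewrite mass_gt0// in Spos.
have [hY hI] := hS.
have inv01 n : 0 <= 1 - n.+1%:R^-1 :> R by rewrite subr_ge0 invf_le1// ler1n.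
pose A n := S `&` [set t | VV t (f t) < VV t (fun w => (1 - n.+1%:R^-1) *: h t w)].
have mA n : measurable (A n).
  have sc := assignment_scale mS (inv01 n) hS.
  exact: (measurable_improvement mu_complete Yp_closed Yp0 q_meas U_reg mS fS sc).
pose D n := S `\` A n.
have mD n : measurable (D n) by exact: measurableD.
have Dni : nonincreasing_seq D.
  move=> n m nm; rewrite subsetEset => t [St nAt]; split=> // -[_ /= Vn]; apply: nAt.
  split=> //=; apply: lt_le_trans Vn _.
  apply: (utility_shrink_le YpZ q_gt0 U_mono) => [w|]; first exact: hY.
  by rewrite inv01 lerD2l lerN2 lef_pV2 ?posrE// ler_nat.
have mDI : measurable (\bigcap_n D n) by exact: bigcapT_measurable.
(* Almost every agent gains strictly, hence tolerates some cut by continuity. *)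
have DI0 : mu (\bigcap_n D n) = 0%E.
  apply/(negligibleP _ mDI); apply: negligibleS ae1 => t /= Dt h1.
  have St : S t by have [] := Dt 0%N I.
  have [_ Vt] := h1 St.
  have [n hn] := utility_shrink_gt YpZ U_reg (fun w => hY t w St) Vt.
  by have [_] := Dt n I; apply.
have Dcvg : mu \o D @ \oo --> 0%E.
  rewrite -DI0; apply: nonincreasing_cvg_mu => //.
  by rewrite ltey_eq mass_fin.
have /choice[yz hyz] : forall w, exists yz : Y * Y,
    [/\ bochner_integral_is mu S (fun t => h t w) yz.1,
      bochner_integral_is mu S (fun t => a t w) yz.2 & Yp (yz.2 - yz.1)].
  by move=> w; have [y [z ?]] := hint w; exists (y, z).
have zint w : interior Yp (yz w).2.
  have [_ ha _] := hyz w.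
  apply: (bochner_integral_interior mu_fin mu_complete Yp_closed Yp0 YpD YpZ mS Spos _ ha).
  by move=> t _; exact: a_interior.
have /choice[del hdel] : forall w, exists del : R, 0 < del /\
    forall A z, measurable A -> A `<=` S -> mass mu A < del ->
    bochner_integral_is mu A (fun t => h t w) z -> interior Yp ((yz w).2 - z).
  move=> w; have [e e0 he] := interior_cone_ball (zint w).
  have [hh _ _] := hyz w.
  have [del del0 hd] := bochner_abs_continuous mu_fin mu_complete mS hh e0.
  exists del; split=> // B z mB BS Bdel hz; apply: he.
  by rewrite addrAC subrr add0r normrN; exact: hd hz.
have [del0 del0pos del0le] := finite_positive_lower_bound (fun w => (hdel w).1).
have [n Dn] : exists n, mass mu (D n) < del0.
  have h0 : (0 < del0%:E :> \bar R)%E by rewrite lte_fin.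
  have hn : \forall n \near \oo, (mu (D n) < del0%:E)%E := Dcvg _ (open_ereal_lt' h0).
  have [n] := @filter_ex _ (\oo : set_system nat) _ _ hn.
  by rewrite massE// lte_fin; exists n.
have AS : A n `<=` S by move=> t [].
pose lam : R := n.+1%:R^-1.
have lam0 : 0 < lam by rewrite invr_gt0.
pose g t w := if t \in A n then (1 - lam) *: h t w else h t w.
have gA t w : A n t -> g t w = (1 - lam) *: h t w by move=> At; rewrite /g mem_set.
have gD t w : D n t -> g t w = h t w by move=> [_ nAt]; rewrite /g memNset.
have gint w : exists y z, [/\ bochner_integral_is mu S (fun t => g t w) y,
      bochner_integral_is mu S (fun t => a t w) z & interior Yp (z - y)].
  have [hh ha surplus] := hyz w.
  have [yA [yD [hyA hyD yE]]] := bochner_integral_split mu_fin mu_complete (mA n) mS AS hh.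
  exists ((1 - lam) *: yA + yD), (yz w).2; split=> //.
    apply: (bochner_integral_merge mu_fin mu_complete (mA n) mS AS).
      apply: (bochner_integral_eq mu_complete (mA n) _
        (bochner_integral_scale mu_fin mu_complete _ (mA n) hyA)).
      by move=> t At; rewrite gA.
    by apply: (bochner_integral_eq mu_complete (mD n) _ hyD) => t Dt; rewrite gD.
  (* A fraction [lam] of the endowment not consumed by [D n], which is interior, plus a fraction
     [1 - lam] of the old surplus, which is in the cone. *)
  have -> : (yz w).2 - ((1 - lam) *: yA + yD) =
      lam *: ((yz w).2 - yD) + (1 - lam) *: ((yz w).2 - (yz w).1).
    have -> : (yz w).2 - (yz w).1 = (yz w).2 - yD - yA.
      by rewrite yE opprD addrA addrAC.
    rewrite [(1 - lam) *: (_ - yA)]scalerBr addrA -scalerDl [lam + _]addrC subrK scale1r.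
    by rewrite opprD addrA addrAC.
  apply: interior_coneD => //; last by apply: YpZ => //; exact: inv01.
  apply: interior_coneZ => //; have [_ hd] := hdel w.
  exact: (hd (D n) yD (mD n) (@subDsetl _ _ _) (lt_le_trans Dn (del0le w)) hyD).
exists g; split=> //.
- split=> [t w St|w]; last by have [y [_ [hy _ _]]] := gint w; exists y.
  have [At|nAt] := pselect (A n t); first by rewrite gA//; by apply: YpZ; [exact: inv01|exact: hY].
  by rewrite gD//; exact: hY.
apply: filterS ae1 => t h1 St; have [Jt Vt] := h1 St.
split; first by move=> w w' ww'; rewrite /g (Jt w w' ww').
have [At|nAt] := pselect (A n t).
  rewrite (_ : g t = fun w => (1 - lam) *: h t w); last by apply/funext => w; rewrite gA.
  by have [_] := At.
by rewrite (_ : g t = h t)//; apply/funext => w; rewrite gD.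
Qed.

End Blocking.

(** * Blocking coalitions of prescribed mass *)

Section BlockingSize.
Context {d} {T : measurableType d} {R : realType} {Y : completeNormedModType R}
  {Omega : finType}.
Variable mu : {measure set T -> \bar R}.
Hypothesis mu_fin : (mu setT < +oo)%E.
Hypothesis mu_complete : complete_measure mu.
Variables (Yp : set Y) (Pi : T -> {set {set Omega}}).
Variables (U : T -> Omega -> Y -> R) (q : T -> Omega -> R) (a : T -> Omega -> Y).
Hypothesis Yp_closed : closed Yp.
Hypothesis Yp0 : Yp 0.
Hypothesis YpD : forall x y, Yp x -> Yp y -> Yp (x + y).
Hypothesis YpZ : forall (c : R) x, 0 <= c -> Yp x -> Yp (c *: x).
Hypothesis q_gt0 : forall t w, 0 < q t w.
Hypothesis q_meas : forall w, measurable_fun setT (fun t => q t w).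
Hypothesis U_reg : A2 Yp U.
Hypothesis U_mono : A3' Yp U.
Hypothesis U_concave : A4' Yp U.
Hypothesis a_interior : forall t w, interior Yp (a t w).
Hypothesis a_meas : forall t, partition_measurable (Pi t) (a t).

Local Notation VV := (V U q).

Hypothesis mu_atomless : atomless mu.
Hypothesis Pi_meas : forall Q : {set {set Omega}}, measurable [set t | Pi t = Q].

Lemma resized_coalition S f g eps : coalition mu S ->
  allocation mu Yp Pi f -> exactly_feasible_on mu a setT f ->
  assignment mu Yp S g ->
  {ae mu, forall t, S t -> join_measurable Pi S (g t) /\ VV t (f t) < VV t (g t)} ->
  (forall w, exists y z, [/\ bochner_integral_is mu S (fun t => g t w) y,
      bochner_integral_is mu S (fun t => a t w) z & interior Yp (z - y)]) ->
  0 < eps -> eps < mass mu setT ->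
  exists S', mass mu S' = eps /\ NY_strongly_fine_blocks mu Yp Pi U q a S' f.
Proof.
move=> [mS Spos] [fT fPi] feas gS ae1 gint eps0 epsT.
rewrite mass_gt0// in Spos.
have [fY fI] := fT; have [gY gI] := gS.
set mT := mass mu setT in epsT *; set m := mass mu S in Spos.
have mC : measurable (~` S) by exact: measurableC.
have mmC : mass mu (~` S) = mT - m.
  have := massID mu_fin (measurableT : measurable [set: T]) mS.
  by rewrite setTI setTD -/mT -/m => ->; rewrite addrC addKr.
have mT0 : 0 < mT by lra.
have m_le : 0 <= mT - m by rewrite -mmC mass_ge0.
pose gam := 1 - eps / mT.
have epsT1 : eps / mT < 1 by rewrite ltr_pdivrMr// mul1r.
have epsT0 : 0 < eps / mT by rewrite divr_gt0.
have gam0 : 0 < gam by rewrite /gam; lra.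
have gam1 : 0 < 1 - gam by rewrite /gam; lra.
pose den := m + (1 - gam) * (mT - m).
have epsden : eps <= den.
  rewrite /den /gam; have -> : m + (1 - (1 - eps / mT)) * (mT - m) = eps + (1 - eps / mT) * m.
    by field; rewrite gt_eqF.
  by rewrite lerDl mulr_ge0//; [lra|exact: ltW].
have den0 : 0 < den by lra.
pose al := eps / den.
have al0 : 0 < al by rewrite divr_gt0.
have al1 : al <= 1 by rewrite ler_pdivrMr// mul1r.
pose be := al * (1 - gam).
have be0 : 0 <= be by rewrite mulr_ge0// ltW.
have be1 : be <= 1.
  by apply: le_trans al1; rewrite ler_piMr//; [exact: ltW|rewrite /gam; lra].
pose base t w := if t \in S then gam *: g t w + (1 - gam) *: f t w else f t w.
have baseS t w : S t -> base t w = gam *: g t w + (1 - gam) *: f t w.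
  by move=> St; rewrite /base mem_set.
have baseC t w : (~` S) t -> base t w = f t w by move=> nSt; rewrite /base memNset.
have baseY t w : Yp (base t w).
  have [St|nSt] := pselect (S t); last by rewrite baseC//; exact: fY.
  rewrite baseS//; apply: YpD; apply: YpZ; [exact: ltW|exact: gY|exact: ltW|exact: fY].
pose net w t := a t w - base t w.
(* The components of [p] are the surplus of [a] over [g] on [S], the integral of [a - f] over [S],
   and the total integral of [base]. Exact feasibility of [f] gives the complement the opposite of
   the second. *)
have data w : exists p : Y * Y * Y, [/\ interior Yp p.1.1,
    bochner_integral_is mu S (net w) (gam *: p.1.1 + (1 - gam) *: p.1.2),
    bochner_integral_is mu (~` S) (net w) (- p.1.2) &
    bochner_integral_is mu setT (fun t => base t w) p.2].
  have [y [z [hg ha zy]]] := gint w.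
  have [x [hf haT]] := feas w.
  have [f1 [f2 [hf1 hf2 fE]]] :=
    bochner_integral_split mu_fin mu_complete mS measurableT (@subsetT _ S) hf.
  have [a1 [a2 [ha1 ha2 aE]]] :=
    bochner_integral_split mu_fin mu_complete mS measurableT (@subsetT _ S) haT.
  rewrite setTD in hf2 ha2.
  have a1z := bochner_integral_unique mu_fin mu_complete mS ha1 ha; subst a1.
  have bS : bochner_integral_is mu S (fun t => base t w) (gam *: y + (1 - gam) *: f1).
    apply: (bochner_integral_eq mu_complete mS _ (bochner_integral_add mu_complete mS
      (bochner_integral_scale mu_fin mu_complete gam mS hg)
      (bochner_integral_scale mu_fin mu_complete (1 - gam) mS hf1))) => t St.
    by rewrite baseS.
  have bC : bochner_integral_is mu (~` S) (fun t => base t w) f2.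
    by apply: (bochner_integral_eq mu_complete mC _ hf2) => t nSt; rewrite baseC.
  exists (z - y, z - f1, gam *: y + (1 - gam) *: f1 + f2); split=> //=.
  - have := bochner_integral_sub mu_complete mS ha bS.
    congr (bochner_integral_is _ _ _ _).
    rewrite !scalerBr addrACA -scalerDl [gam + _]addrC subrK scale1r.
    by rewrite -opprD.
  - have := bochner_integral_sub mu_complete mC ha2 bC.
    congr (bochner_integral_is _ _ _ _).
    have : f1 + f2 = z + a2 by rewrite -fE.
    move=> E; rewrite opprB; apply/eqP; rewrite subr_eq addrAC eq_sym subr_eq.
    by rewrite E addrC.
  - apply: (bochner_integral_merge mu_fin mu_complete mS measurableT (@subsetT _ S) bS).
    by rewrite setTD.
have {data} /choice[p hp] := data.
have Zint w : interior Yp ((al * gam) *: (p w).1.1).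
  by apply: interior_coneZ => //; [exact: mulr_gt0|have [] := hp w].
have /choice[e he] : forall w, exists e : R, 0 < e /\
    forall y, `|y - (al * gam) *: (p w).1.1| < e -> interior Yp y.
  by move=> w; have [e e0 he] := interior_cone_ball (Zint w); exists e.
have [e0 e0pos e0le] := finite_positive_lower_bound (fun w => (he w).1).
have e2 : 0 < e0 / 2 by lra.
(* With these sets cut in the same proportion, [A] meets every [TQ Q] whose trace on [S] has
   positive mass. *)
pose TQ (Q : {set {set Omega}}) := [set t | Pi t = Q].
pose L := [seq TQ Q | Q <- enum {set {set Omega}}].
have mL X : X \in L -> measurable X by move=> /mapP[Q _ ->]; exact: Pi_meas.
have TQL Q : TQ Q \in L by apply: map_f; rewrite mem_enum.
have al01 : 0 <= al <= 1 by rewrite al1 ltW.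
have be01 : 0 <= be <= 1 by rewrite be1 be0.
have netS w : bochner_integral_is mu S (net w)
    (gam *: (p w).1.1 + (1 - gam) *: (p w).1.2) by have [] := hp w.
have netC w : bochner_integral_is mu (~` S) (net w) (- (p w).1.2) by have [] := hp w.
have [A [mA AS AE AL hA]] := approx_lyapunov mu_fin mu_complete mu_atomless mS mL
  al01 e2 netS.
have [B [mB BC BE _ hB]] := approx_lyapunov mu_fin mu_complete mu_atomless mC mL
  be01 e2 netC.
(* [A] may miss the partitions held only by a null part of [S]; adding that
   part makes the joint information of the new coalition at least that of [S]. *)
pose N := \bigcup_(Q in [set Q | mass mu (S `&` TQ Q) = 0]) (S `&` TQ Q).
have mN : measurable N.
  apply: fin_bigcup_measurable; first exact: finite_finset.
  by move=> Q _; apply: measurableI => //; exact: Pi_meas.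
have N0 : mass mu N = 0.
  apply/eqP; rewrite eq_le mass_ge0 andbT leNgt; apply/negP => Npos.
  have cov : {ae mu, forall t, N t -> exists Q, TQ Q t}.
    by apply: aeW => t _; exists (Pi t).
  have [Q NQ] := massive_piece mu_fin mN Npos Pi_meas cov.
  have : (N `&` TQ Q) !=set0.
    by apply/set0P/negP => /eqP NQ0; rewrite NQ0 mass0 ltxx in NQ.
  move=> [t [[Q' /= Q'0 [St tQ']] tQ]].
  have QQ' : Q = Q' by rewrite -tQ -tQ'.
  subst Q'.
  have : mass mu (N `&` TQ Q) <= mass mu (S `&` TQ Q).
    apply: (le_mass mu_fin (measurableI _ _ mN (Pi_meas Q))
      (measurableI _ _ mS (Pi_meas Q))).
    by move=> s [[? _ [? _]] ?].
  by rewrite Q'0; lra.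
pose N' := N `\` A.
have NS : N `<=` S by move=> t [Q _ []].
have mN' : measurable N' by exact: measurableD.
have N'0 : mass mu N' = 0.
  apply/eqP; rewrite eq_le mass_ge0 andbT -N0; apply: le_mass => //.
  exact: subDsetl.
have dAB : A `&` B = set0.
  by apply/seteqP; split=> // t [/AS St /BC]; exact.
have mAB : measurable (A `|` B) by exact: measurableU.
have dN : (A `|` B) `&` N' = set0.
  apply/seteqP; split=> // t [[At|Bt] [Nt nAt]] //.
  exact: (BC _ Bt (NS _ Nt)).
pose S' := (A `|` B) `|` N'.
have mS' : measurable S' by exact: measurableU.
have S'E : mass mu S' = eps.
  rewrite massU// massU// N'0 AE BE mmC addr0 -/m.
  transitivity (al * den); first by rewrite /be /den; ring.
  by rewrite /al divfK// gt_eqF.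
have AS' : A `<=` S' by move=> t At; left; left.
have BS' : B `<=` S' by move=> t Bt; left; right.
(* [S'] knows at least what [S] knows: a partition held by a part of [S] of positive mass is held by
   someone in [A], and an agent of [S] with any other partition lies in [N], hence in [S']. *)
have joinS w w' :
    (forall s, S' s -> finset.pblock (Pi s) w = finset.pblock (Pi s) w') ->
    forall s, S s -> finset.pblock (Pi s) w = finset.pblock (Pi s) w'.
  move=> ww' s Ss; have [sQ0|sQ0] := eqVneq (mass mu (S `&` TQ (Pi s))) 0.
    apply: ww'; have Ns : N s by exists (Pi s).
    by have [As|nAs] := pselect (A s); [exact: AS'|right].
  have : 0 < mass mu (A `&` TQ (Pi s)).
    by rewrite AL// mulr_gt0// lt0r sQ0 mass_ge0.
  move=> AQ; have : (A `&` TQ (Pi s)) !=set0.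
    by apply/set0P/negP => /eqP AQ0; rewrite AQ0 mass0 ltxx in AQ.
  by move=> [s' [As' <-]]; apply: ww'; exact: AS'.
(* The join over [S'] refines the partition of each of its members, so [f t] is admissible. *)
have fPi' : {ae mu, forall t, S' t -> join_measurable Pi S' (f t)}.
  by apply: filterS fPi => t ft S't w w' ww'; apply: ft; exact: ww'.
have baseJ : {ae mu, forall t, S' t -> join_measurable Pi S' (base t)}.
  apply: filterS2 ae1 fPi' => t h1 h2 S't w w' ww'.
  rewrite /base (h2 S't w w' ww'); case: ifPn => // /set_mem St.
  by have [Jt _] := h1 St; rewrite (Jt w w' (joinS w w' ww')).
have netI w : exists v, [/\ bochner_integral_is mu S' (net w) v & Yp v].
  have [kA hkA] := bochner_integrable_subset mu_fin mu_complete mA mS AS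
    (ex_intro _ _ (netS w)).
  have [kB hkB] := bochner_integrable_subset mu_fin mu_complete mB mC BC
    (ex_intro _ _ (netC w)).
  exists (kA + kB); split.
    rewrite -[kA + kB]addr0; apply: bochner_integral_setU => //.
      exact: bochner_integral_setU.
    exact: bochner_integral_null.
  apply: interior_subset; have [_] := he w; apply.
  have h1 := hA w _ hkA; have h2 := hB w _ hkB.
  (* As [be = al * (1 - gam)], the [(p w).1.2] terms cancel; what remains are the two Lyapunov
     errors, each below [e0 / 2]. *)
  have -> : kA + kB - (al * gam) *: (p w).1.1 =
      (kA - al *: (gam *: (p w).1.1 + (1 - gam) *: (p w).1.2)) +
      (kB - be *: - (p w).1.2).
    rewrite addrACA; congr (_ + _).
    by rewrite scalerDr !scalerA scalerN opprK opprD -addrA addNr addr0.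
  apply: le_lt_trans (ler_normD _ _) _; apply: lt_le_trans (e0le w); lra.
have /choice[v hv] := netI.
have vY w : Yp (v w) by have [] := hv w.
(* [eps] is the mass of [S'], so equal shares exactly exhaust the excess [v]. *)
pose h t w := base t w + eps^-1 *: v w.
have hvY w : Yp (eps^-1 *: v w) by apply: YpZ => //; rewrite invr_ge0 ltW.
have bI w : exists b, bochner_integral_is mu S' (fun t => base t w) b.
  have [_ _ _ hb] := hp w.
  exact: (bochner_integrable_subset mu_fin mu_complete mS' measurableT (@subsetT _ S')
    (ex_intro _ _ hb)).
have hfeas w : exists y, bochner_integral_is mu S' (fun t => h t w) y /\
    bochner_integral_is mu S' (fun t => a t w) y.
  have [b hb] := bI w; have [hvw _] := hv w; exists (b + v w); split.
    have := bochner_integral_add mu_complete mS' hb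
      (bochner_integral_cst mu_fin (eps^-1 *: v w) mS').
    by rewrite S'E scalerA divff ?gt_eqF// scale1r.
  apply: (bochner_integral_eq mu_complete mS' _
    (bochner_integral_add mu_complete mS' hb hvw)) => t _.
  by rewrite /net addrC subrK.
have vJ w w' : (forall s, S' s -> finset.pblock (Pi s) w = finset.pblock (Pi s) w') ->
    v w = v w'.
  move=> ww'; have [hw _] := hv w; have [hw' _] := hv w'.
  apply: (join_measurable_integral mu_fin mu_complete (Pi := Pi) (S := S')
    (g := fun t w => net w t) mS' _ _ ww' hw hw') => //.
  apply: filterS baseJ => t hJ S't x x' xx'.
  by rewrite /net (hJ S't x x' xx') (a_meas (xx' t S't)).
(* By concavity the mixture retains at least the fraction [gam] of the strict gain from [g], and the
   share of the excess does no harm. *)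
have VS : {ae mu, forall t, S t -> VV t (f t) < VV t (h t)}.
  apply: filterS ae1 => t h1 St; have [_ Vt] := h1 St.
  have gYt w : Yp (g t w) by exact: gY.
  have fYt w : Yp (f t w) by exact: fY.
  have := utility_le q_gt0 U_mono t (baseY t) hvY; apply: lt_le_trans.
  have gam01 : 0 <= gam <= 1 by rewrite ltW//= /gam; lra.
  have := utility_concave q_gt0 U_concave t gYt fYt gam01.
  rewrite -(_ : base t = fun w => gam *: g t w + (1 - gam) *: f t w); last first.
    by apply/funext => w; rewrite baseS.
  apply: lt_le_trans; rewrite -subr_gt0.
  rewrite (_ : _ - _ = gam * (VV t (g t) - VV t (f t))); last by ring.
  by rewrite mulr_gt0// subr_gt0.
have VC t : (~` S) t -> VV t (f t) <= VV t (h t).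
  move=> nSt; rewrite (_ : f t = base t); last by apply/funext => w; rewrite baseC.
  exact: (utility_le q_gt0 U_mono t (baseY t) hvY).
exists S'; split=> //; split.
  by split=> //; rewrite mass_gt0// S'E.
(* On [B] the improvement is only shown to be weak, so [A] serves as the strictly improving part. *)
exists A, h; split.
- split=> //; split=> //; rewrite mass_gt0// AE; exact: mulr_gt0.
- split=> [t w _|w]; first exact: YpD.
  by have [y [hy _]] := hfeas w; exists y.
- exact: hfeas.
- apply: filterS2 baseJ VS => t hJ hV S't; split.
    by move=> w w' ww'; rewrite /h (hJ S't w w' ww') (vJ w w' ww').
  by have [St|nSt] := pselect (S t); [exact/ltW/hV|exact: VC].
- by apply: filterS VS => t hV /AS; exact: hV.
Qed.

End BlockingSize.

Theorem theorem3p6 (d : measure_display) (T : measurableType d) (R : realType)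
  (Y : completeNormedModType R) (Omega : finType)
  (mu : {measure set T -> \bar R}) (Yp : set Y)
  (Pi : T -> {set {set Omega}}) (U : T -> Omega -> Y -> R)
  (q : T -> Omega -> R) (a : T -> Omega -> Y) :
  standing_setup mu Yp Pi q a ->
  atomless mu ->
  A1 Pi q -> A2 Yp U -> A3' Yp U -> A4' Yp U -> A5 Yp a ->
  forall f : T -> Omega -> Y,
    allocation mu Yp Pi f ->
    exactly_feasible_on mu a setT f ->
    ~ NY_strong_fine_core mu Yp Pi U q a f ->
    forall eps : R, 0 < eps -> (eps%:E < mu setT)%E ->
      exists S : set T, mu S = eps%:E /\
        NY_strongly_fine_blocks mu Yp Pi U q a S f.
Proof.
move=> [[[Ycl Y0 YD YZ _] [_ [mu_complete mu_fin]]] _ [q_gt0 _] [_ a_meas] _] atl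
  [q_meas Pi_meas] U_reg U_mono U_concave a_int f fall feas ncore eps eps0 epsT.
have [S [[mS Spos] [S0 [g [[coS0 S0S] gS gfeas ae1 ae2]]]]] :
    exists S, NY_strongly_fine_blocks mu Yp Pi U q a S f.
  apply: contrapT => no; apply: ncore; split=> //; split=> // S hS.
  by apply: no; exists S.
have fS := assignment_subset mu_fin mu_complete mS measurableT (@subsetT _ S) fall.1.
have [h [hS hae hint]] := block_strictly_everywhere mu_fin mu_complete Ycl Y0 YD YZ
  q_gt0 q_meas U_reg U_mono (conj mS Spos) coS0 S0S fS gS gfeas ae1 ae2.
have [k [kS kae kint]] := block_with_interior_surplus mu_fin mu_complete Ycl Y0 YD YZ
  q_gt0 q_meas U_reg U_mono a_int (conj mS Spos) fS hS hae hint.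
have epsT' : eps < mass mu setT by rewrite -lte_fin -massE.
have [S' [S'E blk]] := resized_coalition mu_fin mu_complete YD YZ q_gt0 U_mono
  U_concave a_meas atl Pi_meas (conj mS Spos) fall feas kS kae kint eps0 epsT'.
exists S'; split=> //; have [[mS' _] _] := blk.
by rewrite massE// S'E.
Qed.
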